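(* Let $k$ and $m$ be positive integers with $1 < k \leq m-1$. Let $\mathcal F$ be an intersecting family of $k$-multisets of $[m]$ such that $\bigcap_{A \in \mathcal F} A = \emptyset$. Then \[|\mathcal F| \leq \binom{m+k-2}{k-1} - \binom{m-2}{k-1} + 1.\] Moreover, if $3 < k < m-1$, equality holds if and only if $\mathcal F$ is isomorphic to \[\widetilde{\mathcal F} = \{A \text{ a } k\text{-multiset of } [m] : 1 \in A \text{ and } A \cap [2,k+1] \neq \emptyset\} \cup \{[2,k+1]\}.\]
   Context: A $k$-multiset of $[m]=\{1,\dots,m\}$ is a multiset of cardinality $k$ (counting repetitions) with elements from $[m]$; $\mathrm{m}(i,A)$ denotes the multiplicity of $i$ in $A$. The intersection of multisets $A,B$ is the multiset $C$ with $\mathrm{m}(i,C)=\min\{\mathrm{m}(i,A),\mathrm{m}(i,B)\}$ (a set is regarded as a multiset with all multiplicities one). A family is intersecting if every two members have nonempty intersection. $[x,y]$ denotes $\{x,x+1,\dots,y\}$. Two families are isomorphic if one is obtained from the other by a permutation of $[m]$. *)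

(* Defs.v *)
From mathcomp Require Import all_boot all_fingroup.
From mathcomp Require Import finmap multiset.

Set Implicit Arguments.
Unset Strict Implicit.
Unset Printing Implicit Defensive.

Local Open Scope fset_scope.
Local Open Scope mset_scope.
Local Open Scope nat_scope.

(* The ground set [m] = {1, ..., m} is represented by 'I_m, the ordinal i
   standing for the element i.+1. Multisets of [m] are terms of {mset 'I_m};
   A i is the multiplicity of i in A and size A counts with repetitions. *)

Definition ground_itv (m x y : nat) : {set 'I_m} := [set i : 'I_m | x <= i.+1 <= y].

Definition mset_of_set (m : nat) (S : {set 'I_m}) : {mset 'I_m} :=
  seq_mset (enum S).

Definition kmsets (m k : nat) : {fset {mset 'I_m}} :=
  [fset seq_mset (val t) | t in {: k.-tuple 'I_m}].

Definition intersecting (m : nat) (F : {fset {mset 'I_m}}) : Prop :=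
  forall A B, A \in F -> B \in F -> (A `&` B)%mset != mset0.

(* msetI has no neutral element: the fold starts from a member of F, which is
   harmless by idempotence. The intersection of the empty family is set to be
   mset0; see mset_bigcapE for nonempty families. *)
Definition mset_bigcap (m : nat) (F : {fset {mset 'I_m}}) : {mset 'I_m} :=
  foldr (@msetI 'I_m) (head mset0 (enum_fset F)) (enum_fset F).

Definition perm_mset (m : nat) (p : {perm 'I_m}) (A : {mset 'I_m}) :
  {mset 'I_m} := seq_mset [seq p i | i <- A].

Definition isomorphic (m : nat) (F G : {fset {mset 'I_m}}) : Prop :=
  exists p : {perm 'I_m}, F = [fset perm_mset p A | A in G].

Definition Ftilde (m k : nat) (hm : 0 < m) : {fset {mset 'I_m}} :=
  let one := Ordinal hm in
  let I2k := mset_of_set (ground_itv m 2 k.+1) in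
  let P (A : {mset 'I_m}) := (one \in A) && ((A `&` I2k)%mset != mset0) in
  ([fset A in kmsets m k | P A] `|` [fset I2k])%fset.

Lemma in_kmsets m k (A : {mset 'I_m}) : (A \in kmsets m k) = (size A == k).
Proof.
apply/imfsetP/eqP => [[t _ ->]|sA].
  by rewrite (perm_size (perm_eq_seq_mset _)) size_tuple.
have sA' : size A == k by apply/eqP.
by exists (Tuple sA'); rewrite //= seq_mset_id.
Qed.

Lemma mset_of_setE m (S : {set 'I_m}) i : mset_of_set S i = (i \in S).
Proof. by rewrite mset_seqE count_uniq_mem ?enum_uniq // mem_enum. Qed.

Lemma mset_bigcapE m (F : {fset {mset 'I_m}}) i n : F != fset0 ->
  (n <= mset_bigcap F i) <-> (forall A, A \in F -> n <= A i).
Proof.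
have foldE (B : {mset 'I_m}) s : (n <= foldr (@msetI _) B s i) <->
    n <= B i /\ (forall A, A \in s -> n <= A i).
  elim: s => [|C s IH] /=; first by split=> [|[]].
  rewrite msetE2 leq_min; split=> [/andP[nC /IH[nB ns]]|[nB ns]].
    by split=> // A; rewrite inE => /orP[/eqP->|/ns].
  rewrite ns ?mem_head //=; apply/IH; split=> // A sA.
  by apply: ns; rewrite inE sA orbT.
move=> /fset0Pn[A0 A0F]; split=> [/foldE[] //|nF].
apply/foldE; split=> //; apply: nF.
rewrite /= -[A0 \in F]/(A0 \in enum_fset F) in A0F.
rewrite -[_ \in F]/(_ \in enum_fset F).
by case: (enum_fset F) A0F => //= a s _; rewrite mem_head.
Qed.

Lemma perm_msetE m (p : {perm 'I_m}) (A : {mset 'I_m}) i :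
  perm_mset p A (p i) = A i.
Proof.
rewrite mset_seqE count_map -count_mem_mset; apply: eq_count => j /=.
by rewrite (inj_eq perm_inj).
Qed.

(* Main.v *)
Require Import Defs.
From mathcomp Require Import all_boot all_fingroup.
From mathcomp Require Import finmap multiset zify.

(* A support of size s carries as many k-multisets of [m] as there are k-subsets
   of [m+k-1] with that trace on [m]. Hence F is at most as large as the family
   F' of the k-subsets of [m+k-1] whose trace contains the support of a member
   of F, and F' is intersecting and nontrivial: the bound is that of Hilton and
   Milner, and when it is attained a single member of F' misses some point,
   which determines F.

   Hilton-Milner is proved by shifting. A family whose shift becomes trivial is
   covered by two points, and its links at these points are cross-intersecting.
   The largest nonempty cross-intersecting pairs (P, Q) of a-sets are found by
   uncrossing (P, Q) with its image under a transposition: if P is as small as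
   possible but is not a singleton, then the classes of "the transposition
   (x y) preserves P" merge into one and P contains every a-set. For a shifted
   family, delete the last point of the ground set and take its link there. *)

Set Implicit Arguments.
Unset Strict Implicit.
Unset Printing Implicit Defensive.

(** * Uniform families and transpositions *)

Section Draws.
Variable T : finType.
Implicit Types (x y z : T) (A F G H L X Y Z : {set T}) (k a : nat).

Definition draws X k := [set A : {set T} | (A \subset X) && (#|A| == k)].

Lemma drawsP X k A : reflect (A \subset X /\ #|A| = k) (A \in draws X k).
Proof. by rewrite inE; apply: (iffP andP) => -[-> /eqP]. Qed.

Lemma card_drawsE X k : #|draws X k| = 'C(#|X|, k).
Proof. exact: cards_draws. Qed.

Lemma exists_draw L Z a : L \subset Z -> #|L| <= a <= #|Z| ->
  exists H, [/\ L \subset H, H \subset Z & #|H| = a].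
Proof.
move=> sLZ /andP[La aZ].
have: 0 < #|draws (Z :\: L) (a - #|L|)|.
  by rewrite card_drawsE bin_gt0 cardsDS // leq_sub2r.
case/card_gt0P=> D /drawsP[]; rewrite subsetD => /andP[sDZ dis] cD.
exists (L :|: D); split; first exact: subsetUl.
  by rewrite subUset sLZ.
rewrite cardsU disjoint_setI0 ?cards0 ?subn0 ?cD ?subnKC //.
by rewrite disjoint_sym.
Qed.

Lemma setI_neq0P F G : reflect (exists2 x, x \in F & x \in G) (F :&: G != set0).
Proof.
apply: (iffP (set0Pn _)) => [[x /setIP[]]|[x xF xG]]; first by exists x.
by exists x; rewrite inE xF.
Qed.

Lemma card_meeting X F a : F \subset X ->
  #|[set H in draws X a | F :&: H != set0]| = 'C(#|X|, a) - 'C(#|X| - #|F|, a).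
Proof.
move=> sFX; rewrite -(cardsDS sFX) -!card_drawsE -cardsDS; last first.
  apply/subsetP=> A /drawsP[sA cA]; apply/drawsP; split=> //.
  exact: subset_trans sA (subsetDl _ _).
apply: eq_card => A; rewrite !inE subsetD -setI_eq0 [A :&: F]setIC.
by case: (A \subset X); rewrite //= ?andbF //; case: (#|A| == a); rewrite ?andbF ?andbT.
Qed.

Lemma card_link X k c (F : {set {set T}}) : F \subset draws X k.+1 ->
  let L := [set A :\ c | A in [set A in F | c \in A]] in
  #|L| = #|[set A in F | c \in A]| /\ L \subset draws (X :\ c) k.
Proof.
move=> sF L; split.
  apply: card_in_imset => A B; rewrite !inE => /andP[_ cA] /andP[_ cB] eAB.
  by rewrite -(setD1K cA) eAB setD1K.
apply/subsetP=> _ /imsetP[A + ->]; rewrite inE => /andP[/(subsetP sF)/drawsP[sA cA] cinA].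
apply/drawsP; split; first exact: setSD.
by have := cardsD1 c A; rewrite cinA cA add1n => -[].
Qed.

Lemma card_star X k c : c \in X ->
  #|[set A in draws X k.+1 | c \in A]| = 'C(#|X|.-1, k).
Proof.
move=> cX; have [<- sL] := @card_link X k c _ (subxx _).
have -> : #|X|.-1 = #|X :\ c| by rewrite [#|X|](cardsD1 c) cX.
rewrite -card_drawsE; apply/eqP; rewrite eqn_leq subset_leq_card //=.
apply/subset_leq_card/subsetP=> B /drawsP[]; rewrite subsetD1 => /andP[sB cB] kB.
apply/imsetP; exists (c |: B); last by rewrite setU1K.
rewrite !inE subUset sub1set cX sB eqxx /=.
by rewrite cardsU1 cB kB add1n eqxx.
Qed.

Lemma card_meeting_star X Y k c : c \in X -> Y \subset X -> c \notin Y ->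
  #|[set A in draws X k.+1 | (c \in A) && (A :&: Y != set0)]| =
  'C(#|X|.-1, k) - 'C(#|X|.-1 - #|Y|, k).
Proof.
move=> cX sYX cY; have <- := card_star k cX.
have cXY : c \in X :\: Y by rewrite inE cY.
have -> : #|X|.-1 - #|Y| = #|X :\: Y|.-1 by rewrite cardsDS //; lia.
rewrite -(card_star k cXY) -cardsDS; last first.
  apply/subsetP=> A; rewrite !inE -andbA => /and3P[+ -> ->]; rewrite subsetD.
  by case/andP=> ->.
apply: eq_card => A; rewrite !inE subsetD -setI_eq0.
case: (A \subset X); rewrite ?andbF //=; case: (c \in A); rewrite ?andbF ?andbT //=.
by case: (#|A| == k.+1); rewrite ?andbF ?andbT.
Qed.

Definition swap x y F := [set z | tperm x y z \in F].

Lemma swapK x y : involutive (swap x y).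
Proof. by move=> F; apply/setP=> z; rewrite !inE tpermK. Qed.

Lemma swapC x y F : swap x y F = swap y x F.
Proof. by apply/setP=> z; rewrite !inE tpermC. Qed.

Lemma card_swap x y F : #|swap x y F| = #|F|.
Proof. exact: card_preimset (@perm_inj _ (tperm x y)). Qed.

Lemma swap_sub x y F X : x \in X -> y \in X -> F \subset X -> swap x y F \subset X.
Proof.
move=> xX yX /subsetP sF; apply/subsetP=> z; rewrite inE => /sF.
by case: tpermP => [->|->|].
Qed.

Lemma swap_draws x y F X a : x \in X -> y \in X ->
  (swap x y F \in draws X a) = (F \in draws X a).
Proof.
move=> xX yX; rewrite !inE card_swap; congr (_ && _).
by apply/idP/idP=> /(swap_sub xX yX); rewrite ?swapK.
Qed.

Lemma swapI x y F G : swap x y (F :&: G) = swap x y F :&: swap x y G.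
Proof. by apply/setP=> z; rewrite !inE. Qed.

Lemma swap_eq0 x y F : (swap x y F == set0) = (F == set0).
Proof. by rewrite -!cards_eq0 card_swap. Qed.

Lemma swap_id x y F : (x \in F) = (y \in F) -> swap x y F = F.
Proof. by move=> e; apply/setP=> z; rewrite inE; case: tpermP => [->|->|]. Qed.

Lemma swapE x y F : x \in F -> y \notin F -> swap x y F = y |: F :\ x.
Proof.
move=> xF yF; apply/setP=> z; rewrite !inE; case: tpermP => [->|->|/eqP/negPf-> /eqP/negPf->].
- by rewrite eqxx (negPf yF) /= orbF; apply/esym; apply: contraNF yF => /eqP<-.
- by rewrite eqxx xF.
- by [].
Qed.

Implicit Types P Q : {set {set T}}.

Definition swapf x y P := [set F | swap x y F \in P].

Lemma card_swapf x y P : #|swapf x y P| = #|P|.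
Proof. exact: card_preimset (inv_inj (swapK x y)). Qed.

Lemma mem_swapf x y P F : (swap x y F \in swapf x y P) = (F \in P).
Proof. by rewrite inE swapK. Qed.

Definition crossing P Q := [forall F in P, forall G in Q, F :&: G != set0].

Lemma crossingP P Q :
  reflect (forall F G, F \in P -> G \in Q -> F :&: G != set0) (crossing P Q).
Proof.
apply: (iffP forall_inP) => [h F G FP|h F FP]; first by move/forall_inP: (h F FP); apply.
by apply/forall_inP=> G; apply: h.
Qed.

Lemma crossingC P Q : crossing P Q = crossing Q P.
Proof. by apply/crossingP/crossingP=> h F G FP GQ; rewrite setIC; apply: h. Qed.

Lemma crossing_swapf x y P Q : crossing P Q -> crossing (swapf x y P) (swapf x y Q).
Proof.
move/crossingP=> h; apply/crossingP=> F G; rewrite !inE => FP GQ.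
by rewrite -(swap_eq0 x y) swapI h.
Qed.

Definition swap_inv P x y := swapf x y P == P.

Lemma swap_inv_refl P x : swap_inv P x x.
Proof.
rewrite /swap_inv; apply/eqP/setP=> F; rewrite inE; congr (_ \in P).
by apply: swap_id.
Qed.

Lemma swap_inv_sym P x y : swap_inv P x y = swap_inv P y x.
Proof.
by rewrite /swap_inv; congr (_ == P); apply/setP=> F; rewrite !inE swapC.
Qed.

(** For distinct points the transposition (x z) is the conjugate of (y z) by (x y). Thus the
    relation is an equivalence, and one can argue with its classes. *)
Lemma swap_inv_trans P y x z : swap_inv P x y -> swap_inv P y z -> swap_inv P x z.
Proof.
rewrite /swap_inv => /eqP exy /eqP eyz.
have [->|nxz] := eqVneq x z; first exact: swap_inv_refl.
have [e|nyz] := eqVneq y z; first by subst; rewrite exy.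
have conj w : tperm x z w = tperm x y (tperm y z (tperm x y w)).
  have -> : tperm x z = (tperm y z ^ tperm x y)%g.
    by rewrite tpermJ tpermR tpermD // eq_sym.
  by rewrite conjgE tpermV !permM.
apply/eqP/setP=> F; rewrite inE.
have -> : swap x z F = swap x y (swap y z (swap x y F)).
  by apply/setP=> w; rewrite !inE conj.
have sub u v (e : swapf u v P = P) G : (swap u v G \in P) = (G \in P).
  by rewrite -{2}e inE.
by rewrite !sub.
Qed.

(** Given an [a]-subset [H] of [X], a member of [P] closest to [H] must be [H] itself: otherwise a
    transposition trades one of its points outside [H] for a missing point of [H]. *)
Lemma swap_inv_draws X a P : P \subset draws X a -> P != set0 ->
  {in X &, forall x y, swap_inv P x y} -> P = draws X a.
Proof.
move=> sP /set0Pn[F0 F0P] inv; apply/eqP; rewrite eqEsubset sP /=.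
apply/subsetP=> H /drawsP[sHX cH].
have [F FP minF] := arg_minnP (fun F : {set T} => #|H :\: F|) F0P.
have /drawsP[sFX cF] := subsetP sP _ FP.
have [/eqP|[x]] := set_0Vmem (H :\: F).
  rewrite finset.setD_eq0 => sHF.
  suff -> : H = F by [].
  by apply/eqP; rewrite eqEcard sHF cH cF /=.
rewrite inE => /andP[xF xH].
have [/eqP|[y]] := set_0Vmem (F :\: H).
  rewrite finset.setD_eq0 => sFH.
  have e : F = H by apply/eqP; rewrite eqEcard sFH cH cF /=.
  by rewrite e xH in xF.
rewrite inE => /andP[yH yF].
have gF : swap y x F \in P.
  have /eqP e := inv y x (subsetP sFX _ yF) (subsetP sHX _ xH).
  by rewrite -e mem_swapf.
have := minF _ gF; rewrite swapE // leqNgt => /negP[].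
apply: proper_card; apply/properP; split.
  apply/subsetP=> z; rewrite !inE !negb_or negb_and negbK => /andP[/andP[_ /orP[/eqP->|->//]]].
  by rewrite (negPf yH).
by exists x; rewrite !inE ?xF ?xH ?eqxx.
Qed.

End Draws.

(** * Cross-intersecting pairs *)

Section Cross.
Variable T : finType.
Implicit Types (x y z : T) (A F G H L X Y Z : {set T}) (k a M : nat).
Implicit Types P Q : {set {set T}}.

Definition cross_pair X a P Q :=
  [&& P \subset draws X a, Q \subset draws X a, P != set0, Q != set0 & crossing P Q].

Lemma cross_pairC X a P Q : cross_pair X a P Q = cross_pair X a Q P.
Proof. by rewrite /cross_pair crossingC; do !case: (_ \subset _); do !case: (_ != set0). Qed.

(** A member of [Q] leaves at least [a] points of [X] free, hence an [a]-set disjoint from it, which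
    [P] cannot contain. *)
Lemma cross_pair_proper X a P Q : 2 * a <= #|X| -> cross_pair X a P Q ->
  P != draws X a.
Proof.
move=> aX /and5P[_ sQ _ /set0Pn[G GQ] /crossingP h]; apply/eqP=> e.
have /drawsP[sG cG] := subsetP sQ _ GQ.
have [|H [_ sH cH]] := @exists_draw _ set0 (X :\: G) a (sub0set _).
  by rewrite cards0 cardsDS // cG; lia.
have HP : H \in P by rewrite e; apply/drawsP; split=> //; apply: subset_trans sH (subsetDl _ _).
have /setI_neq0P[z zH zG] := h _ _ HP GQ.
by have := subsetP sH _ zH; rewrite inE zG.
Qed.

(* For a pair of maximal total size, both (P ∩ gP, Q ∪ gQ) and
   (P ∪ gP, Q ∩ gQ) are crossing, and the sizes of the four families add up to
   twice the maximum. *)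
Lemma cross_pair_uncross X a M P Q x y :
  (forall P' Q', cross_pair X a P' Q' -> #|P'| + #|Q'| <= M) ->
  cross_pair X a P Q -> #|P| + #|Q| = M -> #|P| <= #|Q| ->
  x \in X -> y \in X -> P :&: swapf x y P != set0 ->
  cross_pair X a (P :&: swapf x y P) (Q :|: swapf x y Q) /\
  #|P :&: swapf x y P| + #|Q :|: swapf x y Q| = M.
Proof.
move=> maxM PQ eM lePQ xX yX; 
pose P' : {set {set T}} := swapf x y P; pose Q' : {set {set T}} := swapf x y Q.
rewrite -/P' -/Q' => nz.
case/and5P: (PQ) => sP sQ nP nQ cPQ.
have cPQ' : crossing P' Q' := crossing_swapf x y cPQ.
have sub (R : {set {set T}}) : R \subset draws X a -> swapf x y R \subset draws X a.
  by move/subsetP=> sR; apply/subsetP=> F; rewrite inE => /sR; rewrite swap_draws.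
have meet : cross_pair X a (P :&: P') (Q :|: Q').
  apply/and5P; split=> //.
  - exact: subset_trans (subsetIl _ _) sP.
  - by rewrite subUset sQ sub.
  - by case/set0Pn: nQ => G GQ; apply/set0Pn; exists G; rewrite inE GQ.
  apply/crossingP=> F G; rewrite inE => /andP[FP FP'] /setUP[GQ|GQ'].
    exact: (crossingP _ _ cPQ).
  exact: (crossingP _ _ cPQ').
split=> //; apply/eqP; rewrite eqn_leq maxM //=.
have cP' : #|P'| = #|P| := card_swapf x y P.
have cQ' : #|Q'| = #|Q| := card_swapf x y Q.
have eP : #|P :|: P'| + #|P :&: P'| = #|P| + #|P'| := cardsUI P P'.
have eQ : #|Q :|: Q'| + #|Q :&: Q'| = #|Q| + #|Q'| := cardsUI Q Q'.
have := maxM _ _ meet.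
(* The second pair requires a nonempty [Q :&: Q']. If that is empty, [Q :|: Q'] alone has 2|Q| >=
   |P| + |Q| = M members. *)
have [nQ'|/negPn/eqP e0] := boolP (Q :&: Q' != set0); last first.
  rewrite e0 cards0 in eQ; move: nz; rewrite -card_gt0 => nz.
  lia.
have join : cross_pair X a (P :|: P') (Q :&: Q').
  apply/and5P; split=> //.
  - by rewrite subUset sP sub.
  - exact: subset_trans (subsetIl _ _) sQ.
  - by case/set0Pn: nP => G GP; apply/set0Pn; exists G; rewrite inE GP.
  apply/crossingP=> F G /setUP[FP|FP']; rewrite inE => /andP[GQ GQ'].
    exact: (crossingP _ _ cPQ).
  exact: (crossingP _ _ cPQ').
move=> _; rewrite -(leq_add2l M) -{1 2}eM.
suff -> : #|P| + #|Q| + (#|P| + #|Q|) = #|P :|: P'| + #|Q :&: Q'| + (#|P :&: P'| + #|Q :|: Q'|).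
  by rewrite leq_add2r maxM.
by rewrite addnACA [RHS]addnACA eP [X in _ = _ + X]addnC eQ cP' cQ'.
Qed.

Lemma cross_pair_single X a F Q : cross_pair X a [set F] Q ->
  Q \subset [set H in draws X a | F :&: H != set0].
Proof.
case/and5P=> _ sQ _ _ /crossingP h; apply/subsetP=> H HQ.
by rewrite inE (subsetP sQ) // h // set11.
Qed.

(** If every point were equivalent to [z], there would be a single class, and [P] would contain all
    [a]-sets. *)
Lemma cross_pair_hub X a P Q z : 2 * a <= #|X| -> cross_pair X a P Q ->
  ~ {in X, forall u, swap_inv P u z}.
Proof.
move=> aX PQ hub; case/and5P: (PQ) => sP _ nP _ _.
have /eqP[] := cross_pair_proper aX PQ.
apply: swap_inv_draws => // u v uX vX.
by apply: (@swap_inv_trans _ _ z); rewrite ?hub // swap_inv_sym hub.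
Qed.

(** Two successive optimisations: the total size is made maximal, then the first family as small as
    possible. The floor [t] on its size is 0 for the bound and 2 for the case of equality. *)
Lemma cross_pair_extremal X a P Q t : cross_pair X a P Q -> t <= #|P| <= #|Q| ->
  exists P' Q', [/\ cross_pair X a P' Q', #|P| + #|Q| <= #|P'| + #|Q'|,
    t <= #|P'| <= #|Q'| &
    forall R S, cross_pair X a R S -> #|P'| + #|Q'| <= #|R| + #|S| ->
      t <= #|R| <= #|S| -> #|P'| <= #|R|].
Proof.
move=> PQ tPQ.
pose ok (p : {set {set T}} * {set {set T}}) :=
  cross_pair X a p.1 p.2 && (t <= #|p.1| <= #|p.2|).
have ok0 : ok (P, Q) by rewrite /ok /= PQ.
have [p okp maxp] := arg_maxnP (fun p : {set {set T}} * {set {set T}} => #|p.1| + #|p.2|) ok0.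
pose best q := ok q && (#|p.1| + #|p.2| <= #|q.1| + #|q.2|).
have bp : best p by rewrite /best okp /=.
have [q /andP[/andP[q1 q2] q3] minq] := arg_minnP (fun p : {set {set T}} * {set {set T}} => #|p.1|) bp.
exists q.1, q.2; split=> //; first exact: leq_trans (maxp _ ok0) q3.
move=> R S RS le tR; apply: (minq (R, S)); rewrite /best /ok /= RS tR /=.
exact: leq_trans q3 le.
Qed.

Lemma setD_neq0_card F G : #|F| = #|G| -> F != G -> exists2 x, x \in F & x \notin G.
Proof.
move=> cFG nFG; have [/eqP|[x]] := set_0Vmem (F :\: G); last first.
  by rewrite inE => /andP[]; exists x.
by rewrite finset.setD_eq0 => s; rewrite eqEcard s cFG leqnn in nFG.
Qed.

Lemma setD_union_pick X F G a : 2 * a < #|X| -> #|F| = a -> #|G| = a ->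
  exists z, [/\ z \in X, z \notin F & z \notin G].
Proof.
move=> aX cF cG; have [/eqP|[z]] := set_0Vmem (X :\: (F :|: G)); last first.
  by rewrite !inE negb_or => /andP[/andP[zF zG] zX]; exists z.
rewrite finset.setD_eq0 => /subset_leq_card; rewrite cardsU; lia.
Qed.

(** In an extremal pair two distinct members of the smaller family would produce a hub, so that
    family is a single set [F], and the other one consists of [a]-sets meeting [F]. *)
Lemma cross_bound_ordered X a P Q : 0 < a -> 2 * a < #|X| ->
  (forall R S, cross_pair X a R S -> #|R| <= #|S| -> #|R| + #|S| <= #|P| + #|Q|) ->
  cross_pair X a P Q -> #|P| <= #|Q| ->
  #|P| + #|Q| <= 'C(#|X|, a) - 'C(#|X| - a, a) + 1.
Proof.
move=> a0 aX maxPQ PQ lePQ.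
have tPQ : 0 <= #|P| <= #|Q| by [].
have [P' [Q' [PQ' leM le' min']]] := cross_pair_extremal PQ tPQ.
apply: (leq_trans leM).
have maxM R S : cross_pair X a R S -> #|R| + #|S| <= #|P'| + #|Q'|.
  move=> RS; have [leRS|/ltnW leSR] := leqP #|R| #|S|.
    by apply: leq_trans _ leM; apply: maxPQ.
  by rewrite addnC; apply: leq_trans _ leM; apply: maxPQ; rewrite // cross_pairC.
clear P Q maxPQ PQ lePQ tPQ leM; move: P' Q' PQ' le' min' maxM => P Q PQ lePQ minP maxM.
case/and5P: (PQ) => sP sQ nP nQ _.
have cP F : F \in P -> F \subset X /\ #|F| = a by move/(subsetP sP)/drawsP.
(* A member treating [u] and [v] alike is its own image, so it lies in the intersection and
   uncrossing applies; minimality then forces [P] to equal its image. *)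
have inv F u v : F \in P -> u \in X -> v \in X -> (u \in F) = (v \in F) ->
    swap_inv P u v.
  move=> FP uX vX uv.
  have ne : P :&: swapf u v P != set0.
    by apply/set0Pn; exists F; rewrite !inE swap_id ?FP.
  have [PQ' e] := cross_pair_uncross maxM PQ erefl lePQ uX vX ne.
  have : #|P| <= #|P :&: swapf u v P|.
    apply: minP PQ' _ _; first by rewrite e.
    apply: leq_trans (subset_leq_card (subsetIl _ _)) _.
    exact: leq_trans lePQ (subset_leq_card (subsetUl _ _)).
  move=> leP; rewrite /swap_inv eq_sym eqEcard card_swapf leqnn andbT.
  apply/setIidPl/eqP; rewrite eqEcard subsetIl /=; exact: leP.
have [P1|P1] := leqP #|P| 1.
  have /cards1P[F eP] : #|P| == 1 by rewrite eqn_leq P1 card_gt0.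
  rewrite eP in PQ *; rewrite cards1 addnC leq_add2r.
  have /drawsP[sF cF] : F \in draws X a by apply: (subsetP sP); rewrite eP set11.
  by rewrite -{2}cF -card_meeting //; apply/subset_leq_card/cross_pair_single.
have [F [G [FP GP nFG]]] := card_gt1P P1.
have [[sF cF] [sG cG]] := (cP _ FP, cP _ GP).
have [x xF xG] := setD_neq0_card (etrans cF (esym cG)) nFG.
have [z [zX zF zG]] := setD_union_pick aX cF cG.
have xX := subsetP sF _ xF.
(* Points outside [F] are joined to [z] through [F]; points of [F] are joined to [x] through [F],
   and [x] to [z] through [G]. *)
case: (@cross_pair_hub X a P Q z _ PQ); first exact: ltnW.
have xz : swap_inv P x z by apply: inv GP _ _ _ => //; rewrite (negPf xG) (negPf zG).
move=> u uX; have [uF|uF] := boolP (u \in F); last first.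
  by apply: inv FP _ _ _; rewrite // (negPf uF) (negPf zF).
by apply: swap_inv_trans xz; apply: inv FP _ _ _; rewrite // uF xF.
Qed.

Theorem cross_bound X a P Q : 0 < a -> 2 * a < #|X| -> cross_pair X a P Q ->
  #|P| + #|Q| <= 'C(#|X|, a) - 'C(#|X| - a, a) + 1.
Proof.
move=> a0 aX; wlog lePQ : P Q / #|P| <= #|Q|.
  move=> wl PQ; have [le|/ltnW le] := leqP #|P| #|Q|; first exact: wl.
  by rewrite addnC wl // cross_pairC.
move=> PQ.
pose ok (p : {set {set T}} * {set {set T}}) :=
  cross_pair X a p.1 p.2 && (#|p.1| <= #|p.2|).
have ok0 : ok (P, Q) by rewrite /ok /= PQ.
have [p /andP[p1 p2] maxp] := arg_maxnP (fun p : {set {set T}} * {set {set T}} => #|p.1| + #|p.2|) ok0.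
apply: leq_trans (maxp _ ok0) _; apply: cross_bound_ordered p1 p2 => //.
by move=> R S RS leRS; apply: (maxp (R, S)); rewrite /ok RS.
Qed.


Lemma bin_geq_top n j : 0 < j < n -> n <= 'C(n, j).
Proof.
elim: n j => [|n IH] [|j] // /andP[_ jn]; rewrite binS.
have [jn'|nj] := leqP n j.+1; last first.
  by have := IH j.+1 nj; have : 0 < 'C(n, j) by [rewrite bin_gt0; lia]; lia.
have -> : n = j.+1 by lia.
by rewrite binn binSn add1n.
Qed.

Lemma bin_gt_top n j : 1 < j -> j.+1 < n -> n < 'C(n, j).
Proof.
case: n j => [|n] [|j] // j0 jn; rewrite binS.
by have := @bin_geq_top n j.+1; have := @bin_geq_top n j; lia.
Qed.

(** Suppose that both families have at least two members, and take an extremal pair under this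
    constraint. The members of [P] turn out to share [a.-1] points, and such a pair is too small
    once [a] exceeds 2. *)
Theorem cross_bound_eq X a P Q : 2 < a -> 2 * a < #|X| -> cross_pair X a P Q ->
  'C(#|X|, a) - 'C(#|X| - a, a) + 1 <= #|P| + #|Q| -> #|P| = 1 \/ #|Q| = 1.
Proof.
move=> a2 aX; have a0 : 0 < a by lia.
wlog lePQ : P Q / #|P| <= #|Q|.
  move=> wl PQ geM; have [le|/ltnW le] := leqP #|P| #|Q|; first exact: wl.
  apply/or_comm; apply: wl => //; first by rewrite cross_pairC.
  by rewrite [#|Q| + _]addnC.
move=> PQ geM; left; apply/eqP; rewrite eqn_leq andbC card_gt0.
have -> /= : P != set0 by case/and5P: PQ.
rewrite leqNgt; apply/negP => P2.
have tPQ : 2 <= #|P| <= #|Q| by rewrite P2.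
have [P' [Q' [PQ' leM /andP[P'2 le'] min']]] := cross_pair_extremal PQ tPQ.
have {leM}geM := leq_trans geM leM.
clear P Q PQ lePQ P2 tPQ.
move: P' Q' PQ' P'2 le' min' geM => P Q PQ P2 lePQ minP geM.
have [M dM] : exists M, M = 'C(#|X|, a) - 'C(#|X| - a, a) + 1 by eexists.
rewrite -dM in geM.
have maxM R S : cross_pair X a R S -> #|R| + #|S| <= M by rewrite dM; exact: cross_bound.
have eM : #|P| + #|Q| = M by apply/eqP; rewrite eqn_leq geM maxM.
case/and5P: (PQ) => sP sQ _ _ /crossingP cPQ.
have cP F : F \in P -> F \subset X /\ #|F| = a by move/(subsetP sP)/drawsP.
(* Here uncrossing may shrink [P] to [F] alone. Then the partner attains the bound, so it contains
   every [a]-set meeting [F], among them [H]; but [H] misses both [G] and its image, so neither [Q]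
   nor its image contains it. *)
have inv F G H u v : F \in P -> G \in P -> u \in X -> v \in X ->
    (u \in F) = (v \in F) -> H \in draws X a -> F :&: H != set0 ->
    G :&: H == set0 -> swap u v G :&: H == set0 -> swap_inv P u v.
  move=> FP GP uX vX uv HX FH GH gGH.
  have FPP : F \in P :&: swapf u v P by rewrite !inE swap_id ?FP.
  have ne : P :&: swapf u v P != set0 by apply/set0Pn; exists F.
  have [PQ' e] := cross_pair_uncross maxM PQ eM lePQ uX vX ne.
  have [P'2|P'1] := leqP 2 #|P :&: swapf u v P|.
    have : #|P| <= #|P :&: swapf u v P|.
      apply: minP PQ' _ _; first by rewrite e eM.
      rewrite P'2 /=; apply: leq_trans (subset_leq_card (subsetIl _ _)) _.
      exact: leq_trans lePQ (subset_leq_card (subsetUl _ _)).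
    move=> leP; rewrite /swap_inv eq_sym eqEcard card_swapf leqnn andbT.
    by apply/setIidPl/eqP; rewrite eqEcard subsetIl /=; exact: leP.
  have eF : P :&: swapf u v P = [set F].
    by apply/eqP; rewrite eq_sym eqEcard sub1set FPP cards1.
  rewrite eF cards1 in PQ' e.
  have [sF cF] := cP _ FP.
  have : H \in Q :|: swapf u v Q.
    suff -> : Q :|: swapf u v Q = [set H in draws X a | F :&: H != set0] by rewrite inE HX.
    apply/eqP; rewrite eqEcard cross_pair_single //= card_meeting // cF.
    by rewrite -(leq_add2l 1) e dM addnC.
  rewrite !inE => /orP[HQ|HQ]; first by rewrite (negPf (cPQ _ _ GP HQ)) in GH.
  by rewrite -(swap_eq0 u v) swapI swapK (negPf (cPQ _ _ GP HQ)) in gGH.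
(* A suitable [H] contains [p] and avoids both [G] and [y]; the complement of [y |: G] has at least
   [a] points. *)
have inv' F G p u y : F \in P -> G \in P -> u \in X -> y \in X ->
    (u \in F) = (y \in F) -> p \in F -> p \notin G -> p != y -> u \in G ->
    y \notin G -> swap_inv P u y.
  move=> FP GP uX yX uy pF pG py uG yG; have [[sF cF] [sG cG]] := (cP _ FP, cP _ GP).
  have [| |H [pH sH cH]] := @exists_draw _ [set p] (X :\: (y |: G)) a.
  - by rewrite sub1set !inE negb_or py pG (subsetP sF).
  - rewrite cards1 a0 /= cardsDS ?subUset ?sub1set ?yX ?sG //.
    by rewrite cardsU1 yG cG add1n; clear -aX; lia.
  have dis A : A \subset y |: G -> A :&: H == set0.
    move=> sA; rewrite setIC setI_eq0; have := sH; rewrite subsetD => /andP[_].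
    by apply: disjointWr.
  apply: (inv F G H) => //.
  - by apply/drawsP; split=> //; apply: subset_trans sH (subsetDl _ _).
  - by apply/setI_neq0P; exists p => //; rewrite -sub1set.
  - exact/dis/subsetUr.
  apply: dis; rewrite swapE //; exact: setUS (subsetDl _ _).
have inv_out F G x y : F \in P -> G \in P -> x \in G -> x \notin F -> y \in X ->
    y \notin F -> y \notin G -> swap_inv P x y.
  move=> FP GP xG xF yX yF yG; have [[sF cF] [sG cG]] := (cP _ FP, cP _ GP).
  have nFG : F != G by apply: contraNneq xF => ->.
  have [p pF pG] := setD_neq0_card (etrans cF (esym cG)) nFG.
  apply: (inv' F G p) => //; first exact: subsetP xG.
    by rewrite (negPf xF) (negPf yF).
  by apply: contraNneq yF => <-.
(* All points outside [F :&: G] fall into the class of [z]. *)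
have invI F G z u : F \in P -> G \in P -> F != G -> z \in X -> z \notin F ->
    z \notin G -> u \in X -> u \notin F :&: G -> swap_inv P u z.
  move=> FP GP nFG zX zF zG uX; rewrite inE negb_and.
  have [[sF cF] [sG cG]] := (cP _ FP, cP _ GP).
  have [uF|uF] /= := boolP (u \in F); first by move=> uG; apply: (inv_out G F).
  move=> _; have [uG|uG] := boolP (u \in G); first exact: (inv_out F G).
  have [x xF xG] := setD_neq0_card (etrans cF (esym cG)) nFG.
  apply: (@swap_inv_trans _ _ x); last exact: (inv_out G F).
  by rewrite swap_inv_sym; apply: (inv_out G F).
(* With two points [p] and [y] in [F :\: G], the first provides the [H] that joins each point of
   [F :&: G] to the second, and [z] becomes a hub. *)
have near F G : F \in P -> G \in P -> #|F :\: G| <= 1.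
  move=> FP GP; rewrite leqNgt; apply/negP => /card_gt1P[p [y [+ + npy]]].
  rewrite !inE => /andP[pG pF] /andP[yG yF].
  have [[sF cF] [sG cG]] := (cP _ FP, cP _ GP).
  have nFG : F != G by apply: contraNneq yG => <-.
  have [z [zX zF zG]] := setD_union_pick aX cF cG.
  apply: (@cross_pair_hub X a P Q z (ltnW aX) PQ) => u uX.
  have [uFG|uFG] := boolP (u \in F :&: G); last exact: (invI F G).
  have /setIP[uF uG] := uFG.
  have yX := subsetP sF _ yF.
  apply: (@swap_inv_trans _ _ y); last by rewrite (invI F G) // inE yF.
  by apply: (inv' F G p) => //; rewrite uF yF.
have [F [G [FP GP nFG]]] := card_gt1P P2.
have [[sF cF] [sG cG]] := (cP _ FP, cP _ GP).
have [z [zX zF zG]] := setD_union_pick aX cF cG.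
have [x xF xG] := setD_neq0_card (etrans cF (esym cG)) nFG.
have xX := subsetP sF _ xF.
have [K dK] : exists K, K = F :&: G by eexists.
have sKF : K \subset F by rewrite dK subsetIl.
have sKX := subset_trans sKF sF.
have cK : #|K| = a.-1.
  have := cardsID G F; have := near _ _ FP GP; have : 0 < #|F :\: G|.
    by rewrite card_gt0; apply/set0Pn; exists x; rewrite inE xG.
  rewrite -dK cF; clear -a0; lia.
(* If [w] is not in [F], it is equivalent to [x], and [F] is [K] together with [x]; exchanging the
   two gives the set. *)
have K_add w : w \in X -> w \notin K -> w |: K \in P.
  move=> wX wK.
  have eqK A : A \in P -> w \in A -> K \subset A -> w |: K \in P.
    move=> AP wA sKA; have [_ cA] := cP _ AP.
    suff -> : w |: K = A by [].
    by apply/eqP; rewrite eqEcard subUset sub1set wA sKA cardsU1 wK cK cA /= add1n (prednK a0) leqnn.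
  have [wF|wF] := boolP (w \in F); first exact: eqK FP wF sKF.
  have xw : swap_inv P x w.
    apply: (@swap_inv_trans _ _ z); first by rewrite (invI F G) // inE xF.
    by rewrite swap_inv_sym (invI F G) -?dK.
  have gF : swap x w F \in P by rewrite -(eqP xw) mem_swapf.
  apply: eqK gF _ _; rewrite swapE ?setU11 //.
  apply/subsetP=> t tK; rewrite !inE orbC; apply/orP; left.
  by move: tK; rewrite dK inE => /andP[-> tG]; rewrite andbT; apply: contraNneq xG => <-.
have pick A : A \subset X -> #|A| = a -> exists2 w, w \in X & w \notin K /\ w \notin A.
  move=> sA cA; have [/eqP|[w]] := set_0Vmem (X :\: (K :|: A)); last first.
    by rewrite in_setD in_setU negb_or => /andP[/andP[wK wA] wX]; exists w.
  rewrite finset.setD_eq0 => /subset_leq_card; rewrite cardsU cK cA; clear -aX a0; move: (#|K :&: A|); lia.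
(* A member without [t] in [K] would lack two points of [w |: K] for a suitable [w], against
   [near]. *)
have sKP A : A \in P -> K \subset A.
  move=> AP; apply/subsetP=> t tK; apply/negPn/negP => tA.
  have [sA cA] := cP _ AP.
  have [w wX [wK wA]] := pick _ sA cA.
  have := near _ _ (K_add _ wX wK) AP; rewrite leqNgt => /negP[].
  apply/card_gt1P; exists t, w; rewrite !inE tA wA tK eqxx orbT; split=> //.
  by apply: contraNneq wK => <-.
have leP : #|P| <= #|X| - a.-1.
  rewrite -cK -cardsDS //; apply: leq_trans (leq_imset_card (fun w => w |: K) _).
  apply/subset_leq_card/subsetP=> A AP; have [sA cA] := cP _ AP.
  have : 0 < #|A :\: K| by rewrite cardsDS ?sKP // cA cK; clear -a0; lia.
  case/card_gt0P=> w; rewrite inE => /andP[wK wA]; apply/imsetP; exists w.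
    by rewrite inE wK (subsetP sA).
  by apply/eqP; rewrite eq_sym eqEcard subUset sub1set wA sKP // cardsU1 wK cK cA /= add1n (prednK a0) leqnn.
(* A member of [Q] missing [K] would also miss [w |: K] for some [w]. *)
have leQ : #|Q| <= 'C(#|X|, a) - 'C(#|X| - a.-1, a).
  rewrite -cK -card_meeting //; apply/subset_leq_card/subsetP=> H HQ.
  rewrite inE (subsetP sQ) //=; apply/negP=> KH.
  have /drawsP[sH cH] := subsetP sQ _ HQ.
  have [w wX [wK wH]] := pick _ sH cH.
  have /setI_neq0P[t tw tH] := cPQ _ _ (K_add _ wX wK) HQ.
  case/setU1P: tw => [e|tK]; first by rewrite -e tH in wH.
  by have := in_set0 t; rewrite -(eqP KH) !inE tH tK.
(* By Pascal's rule the total falls short of the bound by at least 'C(|X| - a, a - 1) - (|X| - a),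
   which is positive as 2 < a. *)
have e1 : #|X| - a.-1 = (#|X| - a).+1 by clear -a2 aX; lia.
have := @bin_gt_top (#|X| - a) a.-1.
have : 'C((#|X| - a).+1, a) <= 'C(#|X|, a) by apply: leq_bin2l; clear -a0 aX; lia.
move: eM leP leQ; rewrite dM e1.
have -> : 'C((#|X| - a).+1, a) = 'C(#|X| - a, a) + 'C(#|X| - a, a.-1).
  by have := binS (#|X| - a) a.-1; rewrite prednK.
clear -a2 aX; lia.
Qed.

End Cross.

(** * Families covered by two points *)

(* The Hilton-Milner number of the families of k.+1-sets in an n-set. *)
Definition hm_size n k := 'C(n.-1, k) - 'C(n - k - 2, k) + 1.

Section TwoPoints.
Variable T : finType.
Implicit Types (x y z c : T) (A B X Y : {set T}) (k : nat).
Implicit Types F : {set {set T}}.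

Definition nontrivial F := [forall c, [exists A in F, c \notin A]].

Lemma nontrivialP F :
  reflect (forall c, exists2 A, A \in F & c \notin A) (nontrivial F).
Proof. by apply: (iffP forallP) => h c; apply/exists_inP/h. Qed.

Definition missing F c := [set A in F | c \notin A].

Variables (X : {set T}) (k : nat) (F : {set {set T}}) (i j : T).
Hypotheses (sF : F \subset draws X k.+2) (iF : crossing F F).
Hypotheses (iX : i \in X) (jX : j \in X) (nij : i != j) (kX : 2 * k.+2 < #|X|).

Let Fi := [set A in missing F j | i \in A].
Let Fj := [set A in missing F i | j \in A].
Let F0 := [set A in F | (i \notin A) && (j \notin A)].
Let Fij := [set A in F | (i \in A) && (j \in A)].

Lemma card_missing_pair : #|missing F j| = #|Fi| + #|F0|.
Proof.
rewrite -(cardsID [set A : {set T} | i \in A]); congr (_ + _); apply: eq_card => A; rewrite !inE //.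
by case: (A \in F); case: (i \in A); case: (j \in A).
Qed.

Lemma card_pair_split : #|F| = #|Fij| + #|Fj| + (#|Fi| + #|F0|).
Proof.
rewrite -card_missing_pair -(cardsID [set A : {set T} | j \in A]); congr (_ + _); last first.
  by apply: eq_card => A; rewrite !inE andbC.
rewrite -(cardsID [set A : {set T} | i \in A]); congr (_ + _); apply: eq_card => A; rewrite !inE.
  by case: (A \in F); case: (i \in A); case: (j \in A).
by case: (A \in F); case: (i \in A); case: (j \in A).
Qed.

Let X' := X :\ i :\ j.

Lemma card_ground_pair : #|X'| = #|X| - 2.
Proof.
have := cardsD1 i X; have := cardsD1 j (X :\ i).
by rewrite !inE eq_sym nij iX jX /X' /=; lia.
Qed.

(** A common point of a member through [i] only and a member through [j] only is neither [i] nor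
    [j]. Deleting these points therefore leaves a cross-intersecting pair of (k+1)-sets. *)
Lemma cross_links_bound : Fi != set0 -> Fj != set0 ->
  #|Fi| + #|Fj| <= 'C(#|X| - 2, k.+1) - 'C(#|X| - k - 3, k.+1) + 1 /\
  (1 < k -> 'C(#|X| - 2, k.+1) - 'C(#|X| - k - 3, k.+1) + 1 <= #|Fi| + #|Fj| ->
   #|Fi| = 1 \/ #|Fj| = 1).
Proof.
move=> ni nj.
have sub c d : missing F d \subset draws (X :\ d) k.+2.
  apply/subsetP=> A; rewrite inE => /andP[/(subsetP sF)/drawsP[sA cA] dA].
  by apply/drawsP; rewrite subsetD1 sA dA.
have [] := card_link i (sub i j); rewrite -/Fi => ci si.
have [] := card_link j (sub j i); rewrite -/Fj => cj sj.
set Li := [set _ | _ in _] in ci si; set Lj := [set _ | _ in _] in cj sj.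
have lX : #|X'| - k.+1 = #|X| - k - 3 by rewrite card_ground_pair; lia.
have cr : cross_pair X' k.+1 Li Lj.
  apply/and5P; split=> //.
  - by rewrite /X' setDDl setUC -setDDl.
  - by rewrite -card_gt0 ci card_gt0.
  - by rewrite -card_gt0 cj card_gt0.
  apply/crossingP=> _ _ /imsetP[A + ->] /imsetP[B + ->].
  rewrite !inE => /andP[/andP[AF jA] iA] /andP[/andP[BF iB] jB].
  have /setI_neq0P[z zA zB] := crossingP _ _ iF _ _ AF BF.
  apply/setI_neq0P; exists z; rewrite !inE ?zA ?zB andbT.
    by apply: contraNneq iB => <-.
  by apply: contraNneq jA => <-.
have kX' : 2 * k.+1 < #|X'| by rewrite card_ground_pair; lia.
rewrite -ci -cj -lX -card_ground_pair; split; first exact: cross_bound cr.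
by move=> k1; apply: cross_bound_eq cr.
Qed.

(** Apart from [i] and [j] such a member has [k] points. [Y] is meant to be a member avoiding [i]
    and [j], which these points have to meet; the empty set encodes that there is none. *)
Lemma card_pair_bound Y : Y \subset X -> i \notin Y -> j \notin Y ->
  {in Fij, forall A, A :&: Y != set0} \/ Y = set0 ->
  #|Fij| <= 'C(#|X| - 2, k) - (if Y == set0 then 0 else 'C(#|X| - 2 - #|Y|, k)).
Proof.
move=> sY iY jY meetY.
have [eL sL] := card_link i sF.
have eX1 : #|X :\ i| = #|X|.-1 by have := cardsD1 i X; rewrite iX; lia.
have jX1 : j \in X :\ i by rewrite !inE eq_sym nij.
have le (Z : {set {set T}}) : (forall A, A \in Fij -> A :\ i \in Z) -> #|Fij| <= #|Z|.
  move=> h; have <- : #|[set A :\ i | A in Fij]| = #|Fij|.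
    apply: card_in_imset => A B; rewrite !inE => /and3P[_ iA _] /and3P[_ iB _] eAB.
    by rewrite -(setD1K iA) eAB setD1K.
  by apply/subset_leq_card/subsetP=> _ /imsetP[A AF ->]; apply: h.
have link A : A \in Fij -> A :\ i \in draws (X :\ i) k.+1 /\ j \in A :\ i.
  rewrite !inE => /and3P[AF iA jA]; rewrite [j == i]eq_sym nij jA; split=> //.
  have /drawsP[sA cA] := subsetP sF _ AF; rewrite setSD //=.
  by have := cardsD1 i A; rewrite iA cA add1n => -[->].
have e2 : #|X| - 2 = #|X :\ i|.-1 by rewrite eX1; lia.
have [eY|nY] := eqVneq Y set0.
  rewrite subn0 e2 -(card_star k jX1); apply: le => A /link[h1 h2].
  by rewrite inE h1.
rewrite e2 -(card_meeting_star k jX1 (Y := Y)) //; last first.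
  by rewrite subsetD1 sY iY.
case: meetY => [meetY|e]; last by rewrite e eqxx in nY.
apply: le => A AF; have [h1 h2] := link _ AF; rewrite inE h1 h2 /=.
have /setI_neq0P[z zA zY] := meetY _ AF; apply/setI_neq0P; exists z => //.
by rewrite !inE zA andbT; apply: contraNneq iY => <-.
Qed.

(** Pascal's rule splits the bound into the share of the members through both points and the bound
    of [cross_links_bound]. *)
Lemma hm_pair : hm_size #|X| k.+1 =
  'C(#|X| - 2, k) + ('C(#|X| - 2, k.+1) - 'C(#|X| - k - 3, k.+1)) + 1.
Proof.
rewrite /hm_size (_ : #|X|.-1 = (#|X| - 2).+1) ?binS; last by lia.
rewrite (_ : #|X| - k.+1 - 2 = #|X| - k - 3); last by lia.
have : 'C(#|X| - k - 3, k.+1) <= 'C(#|X| - 2, k.+1) by apply: leq_bin2l; lia.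
lia.
Qed.

Lemma pair_bound : nontrivial F -> F0 = set0 -> #|F| <= hm_size #|X| k.+1.
Proof.
move=> /nontrivialP ntF F00.
have cov A : A \in F -> (i \in A) || (j \in A).
  move=> AF; apply/negPn/negP; rewrite negb_or => h.
  by have := in_set0 A; rewrite -F00 inE AF h.
have ni : Fi != set0.
  have [A AF jA] := ntF j; apply/set0Pn; exists A.
  by rewrite !inE AF jA; have := cov _ AF; rewrite (negPf jA) orbF => ->.
have nj : Fj != set0.
  have [A AF iA] := ntF i; apply/set0Pn; exists A.
  by rewrite !inE AF iA; have := cov _ AF; rewrite (negPf iA) /= => ->.
have [le _] := cross_links_bound ni nj.
have := @card_pair_bound set0 (sub0set _) (negbT (in_set0 i)) (negbT (in_set0 j)) (or_intror erefl).
rewrite eqxx hm_pair card_pair_split F00 cards0; lia.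
Qed.

(** The point is [i] or [j]. If both links are nonempty and no member avoids both points, equality
    forces one link to be a single set, by [cross_links_bound]. *)
Lemma pair_good : 1 < k -> #|F0| <= 1 -> nontrivial F -> hm_size #|X| k.+1 <= #|F| ->
  exists2 x, x \in X & #|missing F x| <= 1.
Proof.
move=> k1 F01 /nontrivialP ntF geF.
have eqi : #|missing F i| = #|Fj| + #|F0|.
  rewrite -(cardsID [set A : {set T} | j \in A]); congr (_ + _); apply: eq_card => A; rewrite !inE //.
  by case: (A \in F); case: (i \in A); case: (j \in A).
have [Fi0|ni] := eqVneq Fi set0.
  by exists j; rewrite // card_missing_pair Fi0 cards0.
have [Fj0|nj] := eqVneq Fj set0.
  by exists i; rewrite // eqi Fj0 cards0.
have [le eq] := cross_links_bound ni nj.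
have [F00|[Y YF0]] := set_0Vmem F0.
  have leij := @card_pair_bound set0 (sub0set _) (negbT (in_set0 i)) (negbT (in_set0 j)) (or_intror erefl).
  rewrite eqxx in leij; rewrite hm_pair card_pair_split F00 cards0 in geF.
  have [|e|e] := eq k1; first by clear -leij geF; lia.
    by exists j; rewrite // card_missing_pair F00 cards0 e.
  by exists i; rewrite // eqi F00 cards0 e.
have F0e : #|F0| = 1.
  by apply/eqP; rewrite eqn_leq F01 card_gt0; apply/set0Pn; exists Y.
move: YF0; rewrite inE => /and3P[YF iY jY].
have /drawsP[sY cY] := subsetP sF _ YF.
have meetY : {in Fij, forall A, A :&: Y != set0}.
  by move=> A; rewrite inE => /andP[AF _]; apply: (crossingP _ _ iF).
have leij := card_pair_bound sY iY jY (or_introl meetY).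
have nY : Y == set0 = false by apply/negbTE; rewrite -card_gt0 cY.
rewrite nY cY in leij; rewrite hm_pair card_pair_split F0e in geF.
(* Meeting [Y] costs the members through both points at least two sets, while [Y] itself adds only
   one, so the bound is not reached. *)
have : 1 < 'C(#|X| - 2 - k.+2, k).
  by apply: leq_trans (@bin_geq_top _ _ _); clear -k1 kX; lia.
have : 'C(#|X| - 2 - k.+2, k) <= 'C(#|X| - 2, k) by apply: leq_bin2l; clear; lia.
clear -leij geF le; lia.
Qed.

End TwoPoints.

(** * Shifting *)

Section Shift.
Variable T : finType.
Implicit Types (x y z c i j : T) (A B X Y : {set T}) (k : nat).
Implicit Types F : {set {set T}}.

(** The usual compression towards [i]. Sets containing neither point are fixed by [swap], hence by
    both branches. *)
Definition shift_set i j F A :=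
  if (i \in A) || (swap i j A \in F) then A else swap i j A.

Definition shift i j F := [set shift_set i j F A | A in F].

Lemma shift_set_moved i j F A : A \in F -> shift_set i j F A != A ->
  [/\ i \notin A, j \in A, swap i j A \notin F & shift_set i j F A = swap i j A].
Proof.
rewrite /shift_set => AF; case: ifP; rewrite ?eqxx // => /norP[iA gA] ne; split=> //.
by apply: contraTT gA => jA; rewrite swap_id ?AF // (negPf iA) (negPf jA).
Qed.

Lemma card_shift i j F : #|shift i j F| = #|F|.
Proof.
apply: card_in_imset => A B AF BF; rewrite /shift_set.
case: ifP => [hA|/norP[iA gA]]; case: ifP => [hB|/norP[iB gB]] //.
- by move=> e; rewrite -e AF in gB.
- by move=> e; rewrite e BF in gA.
- exact: (inv_inj (swapK i j)).
Qed.

Lemma shift_draws X k i j F : i \in X -> j \in X -> F \subset draws X k ->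
  shift i j F \subset draws X k.
Proof.
move=> iX jX /subsetP sF; apply/subsetP=> _ /imsetP[A AF ->].
by rewrite /shift_set; case: ifP; rewrite ?swap_draws // sF.
Qed.

(** Two moved sets are images under the same transposition. If [B] moves and [A] stays, either [i]
    is in [A] and in the image of [B], or the image of [A] is in [F] and meets [B]. *)
Lemma shift_crossing i j F : crossing F F -> crossing (shift i j F) (shift i j F).
Proof.
move/crossingP=> h; apply/crossingP=> _ _ /imsetP[A AF ->] /imsetP[B BF ->].
wlog mB : A B AF BF / shift_set i j F B != B.
  move=> wl; have [eB|nB] := eqVneq (shift_set i j F B) B; last exact: wl.
  have [eA|nA] := eqVneq (shift_set i j F A) A; first by rewrite eA eB h.
  by rewrite setIC; apply: wl.
have [iB jB gB ->] := shift_set_moved BF mB.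
have [eA|nA] := eqVneq (shift_set i j F A) A; last first.
  by have [_ _ _ ->] := shift_set_moved AF nA; rewrite -swapI swap_eq0 h.
rewrite eA; have [iA|iA] := boolP (i \in A).
  by apply/setI_neq0P; exists i; rewrite // inE tpermL.
have gA : swap i j A \in F.
  apply/negPn/negP => gA.
  move: eA; rewrite /shift_set (negPf iA) (negPf gA) /= => eA.
  by rewrite eA AF in gA.
by rewrite -(swap_eq0 i j) swapI swapK h.
Qed.

Lemma shift_missing_both i j F :
  [set A in shift i j F | (i \notin A) && (j \notin A)] =
  [set A in F | (i \notin A) && (j \notin A)].
Proof.
apply/setP=> A; rewrite !inE; apply: andb_id2r => /andP[iA jA].
have fixA : swap i j A = A by rewrite swap_id // (negPf iA) (negPf jA).
apply/imsetP/idP => [[B BF eA]|AF].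
  have [e|nB] := eqVneq (shift_set i j F B) B; first by rewrite eA e.
  have [iB jB gB e] := shift_set_moved BF nB.
  by rewrite eA e !inE tpermL jB in iA.
by exists A; rewrite // /shift_set fixA AF orbT.
Qed.

(** A new common point can only be [i], since some member acquires it by moving. Sets avoiding [i]
    and [j] are unaffected by the shift, so there are none. *)
Lemma shift_nontrivial i j F : nontrivial F -> ~~ nontrivial (shift i j F) ->
  [set A in F | (i \notin A) && (j \notin A)] = set0.
Proof.
move/nontrivialP=> ntF /forallPn[c /exists_inPn hc].
have cs A : A \in F -> c \in shift_set i j F A.
  by move=> AF; apply/negPn/hc; apply: imset_f.
have [A AF cA] := ntF c; have := cs _ AF.
have [->|nA] := eqVneq (shift_set i j F A) A; first by rewrite (negPf cA).
have [iA jA gA ->] := shift_set_moved AF nA; rewrite inE => cgA.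
have ci : c = i by move: cgA; case: tpermP => // [->|]; rewrite ?(negPf iA) // (negPf cA).
rewrite -shift_missing_both; apply/setP=> B; rewrite !inE.
by apply/negP=> /andP[/hc]; rewrite negbK ci => ->.
Qed.

(** This carries the case of equality back along a shift. A point other than [i] and [j] stays where
    it is; if [x] is one of them, all members avoiding both are counted among those missing [x]. *)
Lemma shift_missing i j F x : #|missing (shift i j F) x| <= 1 ->
  #|[set A in F | (i \notin A) && (j \notin A)]| <= 1 \/ #|missing F x| <= 1.
Proof.
move=> le1; have [xij|nxij] := boolP (x \in [set i; j]).
  left; rewrite -shift_missing_both; apply: leq_trans le1; apply/subset_leq_card/subsetP=> A.
  rewrite !inE => /and3P[-> iA jA]; move: xij; rewrite !inE.
  by case/orP=> /eqP->.
right; apply: leq_trans le1; rewrite -(card_shift i j).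
(* Shifting the subfamily tests membership in the subfamily, whereas the image below tests it in
   [F]; both maps are injective, so the sizes agree. *)
have -> : #|shift i j (missing F x)| = #|[set shift_set i j F A | A in missing F x]|.
  rewrite card_shift; apply/esym/card_in_imset => A B; rewrite !inE => /andP[AF _] /andP[BF _].
  have := card_shift i j F; move/eqP/imset_injP; exact.
apply/subset_leq_card/subsetP=> _ /imsetP[A + ->]; rewrite !inE => /andP[AF xA].
rewrite imset_f //= /shift_set; case: ifP => // _; rewrite inE.
by move: nxij; rewrite !inE => /norP[xi xj]; rewrite tpermD // eq_sym.
Qed.

Definition weight (f : T -> nat) A := \sum_(z in A) f z.

Lemma weight_swap f i j A : i \notin A -> j \in A ->
  weight f (swap i j A) + f j = weight f A + f i.
Proof.
move=> iA jA; rewrite swapC swapE // /weight big_setU1 /=; last first.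
  by rewrite !inE (negPf iA) andbF.
by rewrite [X in _ = X + _](big_setD1 j) //=; lia.
Qed.

(** Each moved set loses [f j - f i]. The total weight is the measure that makes repeated shifting
    stop. *)
Lemma shift_weight f i j F : f i < f j -> shift i j F != F ->
  \sum_(A in shift i j F) weight f A < \sum_(A in F) weight f A.
Proof.
move=> fij nF; rewrite big_imset /=; last by apply/imset_injP; rewrite -/(shift i j F) card_shift.
have le A : A \in F -> weight f (shift_set i j F A) <= weight f A ?= iff (shift_set i j F A == A).
  move=> AF; have [->|nA] := eqVneq; first exact/leqif_refl.
  have [iA jA _ ->] := shift_set_moved AF nA.
  by apply/leqifP => /=; have := weight_swap f iA jA; lia.
have := leqif_sum (I := [the finType of {set T}]) (P := mem F) le.
move=> [leS eqS]; rewrite ltn_neqAle leS andbT eqS; apply: contraNN nF => /forall_inP h.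
rewrite eqEcard card_shift leqnn andbT; apply/subsetP=> _ /imsetP[A AF ->].
by rewrite (eqP (h _ AF)).
Qed.

Lemma shift_id_swap i j F A : shift i j F = F -> A \in F -> i \notin A ->
  swap i j A \in F.
Proof.
move=> eF AF iA; apply/negPn/negP => gA.
have : shift_set i j F A \in F by rewrite -{2}eF imset_f.
by rewrite /shift_set (negPf iA) (negPf gA) /= (negPf gA).
Qed.

End Shift.

(** * The Hilton-Milner theorem *)

Section HiltonMilner.
Variable N : nat.
Notation T := 'I_N.
Implicit Types (i j x y z c : T) (A B Y : {set T}) (n k : nat).
Implicit Types F : {set {set T}}.

Definition initial n : {set T} := [set i : T | i < n].

Lemma card_initial n : n <= N -> #|initial n| = n.
Proof.
elim: n => [|n IH] nN.
  by apply/eqP; rewrite cards_eq0; apply/eqP/setP=> i; rewrite !inE.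
have -> : initial n.+1 = Ordinal nN |: initial n.
  by apply/setP=> i; rewrite !inE -val_eqE /= ltnS leq_eqVlt.
by rewrite cardsU1 inE /= ltnn IH // ltnW.
Qed.

Definition shifted n F := forall i j A, i < j -> j < n -> A \in F ->
  i \notin A -> swap i j A \in F.

(** The case of equality records only a point that at most one member misses; this is all that the
    reduction from multisets uses. *)
Definition hm_spec n k F :=
  #|F| <= hm_size n k.+1 /\
  (1 < k -> hm_size n k.+1 <= #|F| -> exists2 x, x \in initial n & #|missing F x| <= 1).

(** The bound for a nontrivial link against the one for a trivial link. By Pascal's rule they differ
    by 'C(n - k - 3, k - 1) - 1. *)
Lemma hm_lt n k : 2 * k.+2 <= n -> 0 < k ->
  hm_size n k <= 'C(n.-1, k) - 'C(n.-1 - k.+2, k) ?= iff (k == 1).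
Proof.
case: k => // k kn _; rewrite /hm_size.
have -> : n - k.+1 - 2 = (n.-1 - k.+3).+1 by lia.
rewrite binS; have : 'C((n.-1 - k.+3).+1, k.+1) <= 'C(n.-1, k.+1).
  by apply: leq_bin2l; lia.
rewrite binS => le.
have b0 : 0 < 'C(n.-1 - k.+3, k) by rewrite bin_gt0; lia.
have bk : 0 < k -> 1 < 'C(n.-1 - k.+3, k).
  by move=> k0; apply: leq_trans (@bin_geq_top _ _ _); lia.
apply/leqifP; case: k kn le b0 bk => [|k] kn le b0 bk /=.
  by rewrite bin0; apply/eqP; move: le; rewrite bin0; lia.
by have := bk isT; lia.
Qed.


(** * Shifted families: deleting the last point *)

Section Step.
Variables (n k : nat) (F : {set {set T}}).
Hypotheses (nN : n < N) (kn : 2 * k.+2 <= n).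
Hypotheses (sF : F \subset draws (initial n.+1) k.+2) (iF : crossing F F).
Hypotheses (ntF : nontrivial F) (shF : shifted n.+1 F).

Let o : T := Ordinal (leq_ltn_trans (leq0n n) nN).
Let l : T := Ordinal nN.
Let Y0 : {set T} := [set i : T | 0 < i <= k.+2].

Let cF A : A \in F -> A \subset initial n.+1 /\ #|A| = k.+2.
Proof. by move/(subsetP sF)/drawsP. Qed.

Let initial_last : initial n.+1 :\ l = initial n.
Proof.
by apply/setP=> i; rewrite !inE -val_eqE /= ltnS [i < n]ltn_neqAle.
Qed.

Let sY0 : Y0 \subset initial n.
Proof. by apply/subsetP=> i; rewrite !inE; clear -kn; lia. Qed.

Let cY0 : #|Y0| = k.+2.
Proof.
have -> : Y0 = initial k.+3 :\ o by apply/setP=> i; rewrite !inE -val_eqE /= lt0n ltnS.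
have := cardsD1 o (initial k.+3); rewrite card_initial; last by clear -kn nN; lia.
by rewrite inE add1n => -[].
Qed.

(** A member avoiding [o] of least weight must be [Y0]: otherwise it can trade a point outside [Y0]
    for a smaller one of [Y0]. *)
Lemma shifted_first_mem : Y0 \in F.
Proof.
have [A0 A0F oA0] := nontrivialP _ ntF o.
pose ok A := (A \in F) && (o \notin A).
have P0 : ok A0 by rewrite /ok A0F.
have [A /andP[AF oA] minA] := arg_minnP (weight (@nat_of_ord N)) P0.
have [sA cA] := cF AF.
have [<-//|nA] := eqVneq A Y0.
have [i iY iA] := setD_neq0_card (etrans cY0 (esym cA)) (contra_neq (@esym _ _ _) nA).
have [j jA jY] := setD_neq0_card (etrans cA (esym cY0)) nA.
have nj : j != o by apply: contraNneq oA => <-.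
have ni : i != o by apply: contraTneq iY => ->; rewrite inE.
have ij : i < j by move: iY jY nj; rewrite !inE -val_eqE /=; clear; lia.
have jn : j < n.+1 by have := subsetP sA _ jA; rewrite inE.
have gF : swap i j A \in F by apply: shF.
have := minA (swap i j A); rewrite /ok gF inE tpermD // oA => /(_ isT).
by move=> le; have := leq_add le ij; rewrite weight_swap // addnS ltnn.
Qed.

(** [Y0] misses every point outside it, and for [c] in [Y0] its exchange with [o] gives a member
    missing [c]. None of these contains [l]. *)
Lemma shifted_missing_last_nontrivial : nontrivial (missing F l).
Proof.
have lY0 : l \notin Y0 by rewrite inE /=; clear -kn; lia.
apply/nontrivialP=> c; have [cY|cY] := boolP (c \in Y0); last first.
  by exists Y0; rewrite // inE shifted_first_mem.
have oY : o \notin Y0 by rewrite inE.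
have := cY; rewrite inE => /andP[c0 ck].
exists (swap o c Y0); last by rewrite inE tpermR.
rewrite inE shF ?shifted_first_mem //=; last by clear -kn ck; lia.
by rewrite inE tpermD // -val_eqE /=; clear -kn ck; lia.
Qed.

Let F1 : {set {set T}} := [set A :\ l | A in [set A in F | l \in A]].

Let cF1 : #|F1| = #|[set A in F | l \in A]|.
Proof. by have [] := card_link l sF. Qed.

Let sF1 : F1 \subset draws (initial n) k.+1.
Proof. by have [_] := card_link l sF; rewrite initial_last. Qed.

Let F1P A : A \in F1 -> l \notin A /\ l |: A \in F.
Proof.
case/imsetP=> B; rewrite inE => /andP[BF lB] ->.
by rewrite setD1K // !inE eqxx.
Qed.

Let F1I A : l \notin A -> l |: A \in F -> A \in F1.
Proof.
move=> lA AF; apply/imsetP; exists (l |: A); first by rewrite inE AF setU11.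
by rewrite setU1K.
Qed.

(** If [A] and [B] were disjoint, [l |: A] and [l |: B] would leave some [x < l] uncovered.
    Replacing [l] by [x] in the first gives a member disjoint from the second. *)
Lemma shifted_link_crossing : crossing F1 F1.
Proof.
apply/crossingP=> A B AF1 BF1; apply/negP=> /eqP AB.
have [lA AF] := F1P AF1; have [lB BF] := F1P BF1.
have [sA cA] := cF AF; have [sB cB] := cF BF.
have [/eqP|[x]] := set_0Vmem (initial n.+1 :\: ((l |: A) :|: (l |: B))).
  rewrite finset.setD_eq0 => /subset_leq_card; rewrite card_initial // cardsU cA cB.
  have : 0 < #|(l |: A) :&: (l |: B)|.
    by rewrite card_gt0; apply/setI_neq0P; exists l; rewrite setU11.
  by clear -kn; lia.
rewrite !inE !negb_or => /andP[/and3P[/andP[xl xA] _ xB] xn].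
have xl' : x < l by move: xl xn; rewrite -val_eqE /=; clear; lia.
have gF : swap x l (l |: A) \in F.
  by apply: shF => //; rewrite !inE negb_or xl.
have /setI_neq0P[z] := crossingP _ _ iF _ _ gF BF.
rewrite swapC swapE ?setU11 ?setU1K //; last by rewrite in_setU1 negb_or xl.
case/setU1P=> [->|zA].
  rewrite in_setU1; by rewrite (negPf xl) (negPf xB).
case/setU1P=> [zl|zB]; first by rewrite zl (negPf lA) in zA.
by have := in_set0 z; rewrite -AB inE zA zB.
Qed.

(** Let [c] be common to the link. If a set of the link avoided [o], exchanging [c] for [o] would
    give one without [c]. The sets meet [Y0] because [Y0] is a member without [l]. *)
Lemma shifted_link_trivial : ~~ nontrivial F1 ->
  F1 \subset [set A in draws (initial n) k.+1 | (o \in A) && (A :&: Y0 != set0)].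
Proof.
move=> /forallPn[c /exists_inPn hc]; apply/subsetP=> A AF1.
have [lA AF] := F1P AF1.
rewrite inE (subsetP sF1) //=; apply/andP; split; last first.
  have /setI_neq0P[z] := crossingP _ _ iF _ _ AF shifted_first_mem.
  case/setU1P=> [->|zA zY]; first by rewrite inE /=; clear -kn; lia.
  by apply/setI_neq0P; exists z.
apply/negPn/negP=> oA.
have /negPn cA := hc _ AF1.
have nco : c != o by apply: contraNneq oA => <-.
have nlo : l != o by rewrite -val_eqE /=; clear -kn; lia.
have ncl : c != l by apply: contraNneq lA => <-.
have /drawsP[sA _] := subsetP sF1 _ AF1.
have := subsetP sA _ cA; rewrite inE => cn.
have gF : swap o c (l |: A) \in F.
  apply: shF => //.
  - by move: nco; rewrite -val_eqE /= lt0n.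
  - by rewrite ltnS ltnW.
  - by rewrite !inE negb_or eq_sym nlo.
have gE : swap o c (l |: A) = l |: swap o c A.
  apply/setP=> z; rewrite !inE; case: tpermP => [->|->|//].
    by rewrite (negPf ncl) eq_sym (negPf nlo).
  by rewrite (negPf ncl) eq_sym (negPf nlo).
rewrite gE in gF.
have := hc (swap o c A); rewrite F1I //.
  by move/(_ isT); rewrite !inE tpermR oA.
by rewrite inE tpermD // eq_sym.
Qed.

Hypothesis IH : forall k' F', 2 * k'.+2 <= n -> F' \subset draws (initial n) k'.+2 ->
  crossing F' F' -> nontrivial F' -> #|F'| <= hm_size n k'.+1.

Let b := 'C(n.-1, k) - 'C(n.-1 - k.+2, k).

Lemma shifted_link_bound : #|F1| <= b /\ (1 < k -> nontrivial F1 -> #|F1| < b).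
Proof.
have [nt|nt] := boolP (nontrivial F1); last first.
  split=> //; apply: leq_trans (subset_leq_card (shifted_link_trivial nt)) _.
  by rewrite card_meeting_star ?cY0 ?card_initial ?inE //=; try exact: ltnW; clear -kn; lia.
(* For [k = 0] the link consists of singletons, which coincide as they cross, so it cannot be
   nontrivial. *)
have [k0|k0] := posnP k.
  have [A AF _] := nontrivialP _ nt o.
  have /drawsP[_ /eqP] := subsetP sF1 _ AF; rewrite k0 => /cards1P[a eA].
  have [B BF aB] := nontrivialP _ nt a.
  have := crossingP _ _ shifted_link_crossing _ _ AF BF.
  by rewrite eA => /setI_neq0P[z /set1P->]; rewrite (negPf aB).
have : #|F1| <= hm_size n k.
  rewrite -(prednK k0); apply: IH => //; first by clear -kn k0; lia.
    by rewrite prednK.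
  exact: shifted_link_crossing.
have [le eq] := hm_lt kn k0; rewrite -/b in le eq *.
move=> leF; split=> [|k1 _]; first exact: leq_trans leF le.
by apply: leq_ltn_trans leF _; rewrite ltn_neqAle le eq andbT neq_ltn k1 orbT.
Qed.

(** Pascal's rule splits the bound for [n.+1] into those for the link at [l] and for the members
    without [l]. Under equality the link is the whole family of [shifted_link_trivial], and this
    leaves [Y0] as the only member missing [o]. *)
Lemma shifted_step : hm_spec n.+1 k F.
Proof.
have eF : #|F| = #|F1| + #|missing F l|.
  rewrite cF1 -(cardsID [set A : {set T} | l \in A]).
  by congr (_ + _); apply: eq_card => A; rewrite !inE // andbC.
have le0 : #|missing F l| <= hm_size n k.+1.
  apply: IH => //.
  - apply/subsetP=> A; rewrite inE => /andP[AF lA]; have [sA cA] := cF AF.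
    by apply/drawsP; rewrite -initial_last subsetD1 sA.
  - apply/crossingP=> A B; rewrite !inE => /andP[AF _] /andP[BF _].
    exact: (crossingP _ _ iF).
  - exact: shifted_missing_last_nontrivial.
have [le1 lt1] := shifted_link_bound.
have hmS : hm_size n.+1 k.+1 = b + hm_size n k.+1.
  rewrite /hm_size /b -{1}(prednK (_ : 0 < n)) ?binS /=; last by clear -kn; lia.
  have -> : n.+1 - k.+1 - 2 = (n - k.+1 - 2).+1 by clear -kn; lia.
  have -> : n.-1 - k.+2 = n - k.+1 - 2 by clear; lia.
  rewrite binS.
  have : 'C(n - k.+1 - 2, k.+1) <= 'C(n.-1, k.+1) by apply: leq_bin2l; clear; lia.
  have : 'C(n - k.+1 - 2, k) <= 'C(n.-1, k) by apply: leq_bin2l; clear; lia.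
  by clear; lia.
split; first by rewrite eF hmS leq_add.
rewrite eF hmS => k1 ge.
have geb : b <= #|F1| by rewrite -(leq_add2r (hm_size n k.+1)) (leq_trans ge) // leq_add2l.
have nt : ~~ nontrivial F1 by apply/negP => /(lt1 k1); rewrite ltnNge geb.
have eF1 : F1 = [set A in draws (initial n) k.+1 | (o \in A) && (A :&: Y0 != set0)].
  apply/eqP; rewrite eqEcard shifted_link_trivial //=.
  by rewrite card_meeting_star ?cY0 ?card_initial ?inE //=; try exact: ltnW; clear -kn; lia.
exists o; first by rewrite inE.
suff /subset_leq_card : missing F o \subset [set Y0] by rewrite cards1.
apply/subsetP=> B; rewrite !inE => /andP[BF oB].
apply/eqP/esym/eqP/negPn/negP => nB.
have [sB cB] := cF BF.
have [y yY yB] := setD_neq0_card (etrans cY0 (esym cB)) nB.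
have oy : y != o by apply: contraTneq yY => ->; rewrite inE.
have [lB|lB] := boolP (l \in B).
  have : B :\ l \in F1 by apply: F1I; rewrite ?setD1K // !inE eqxx.
  by rewrite eF1 !inE (negPf oB) andbF /= andbF.
have sB' : B \subset initial n by rewrite -initial_last subsetD1 sB.
(* A set through [o] and [y] that avoids [B] belongs to the link, but adding [l] to it gives a
   member disjoint from [B]. *)
have [||A [sA sAn cA]] := @exists_draw _ [set o; y] (initial n :\: B) k.+1.
- by rewrite subUset !sub1set !in_setD oB yB (subsetP sY0 _ yY) inE /=; clear -kn; lia.
- by rewrite cards2 eq_sym oy cardsDS // card_initial ?cB ?(ltnW nN) //; clear -kn k1; lia.
have : A \in F1.
  move: sA; rewrite subUset !sub1set => /andP[oA yA].
  rewrite eF1 inE oA /=; apply/andP; split; last by apply/setI_neq0P; exists y.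
  by apply/drawsP; split=> //; apply: subset_trans sAn (subsetDl _ _).
case/F1P=> lA AF.
have /setI_neq0P[z] := crossingP _ _ iF _ _ AF BF.
case/setU1P=> [->|zA zB]; first by rewrite (negPf lB).
by have := subsetP sAn _ zA; rewrite inE zB.
Qed.

End Step.


(** At most one set of each complementary pair is in [F], so [F] has at most half of all sets. This
    half is the bound, since its subtracted binomial is 'C(k+1, k+1) = 1. *)
Lemma hilton_milner_complement n k F : n <= N -> n = 2 * k.+2 ->
  F \subset draws (initial n) k.+2 -> crossing F F -> #|F| <= hm_size n k.+1.
Proof.
move=> nN en sF /crossingP iF; have cI := card_initial nN.
pose C := [set initial n :\: A | A in F].
have cC : #|C| = #|F|.
  apply: card_in_imset => A B /(subsetP sF)/drawsP[sA _] /(subsetP sF)/drawsP[sB _] e.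
  have inv (D : {set T}) : D \subset initial n -> initial n :\: (initial n :\: D) = D.
    by move=> sD; rewrite setDDr setDv set0U; apply/setIidPr.
  by rewrite -(inv _ sA) e inv.
have dis : [disjoint F & C].
  apply/pred0P=> A /=; apply/negP=> /andP[AF /imsetP[B BF e]].
  by have /setI_neq0P[z] := iF _ _ AF BF; rewrite e inE => /andP[/negPf->].
have : #|F :|: C| <= #|draws (initial n) k.+2|.
  apply/subset_leq_card; rewrite subUset sF /=; apply/subsetP=> _ /imsetP[A AF ->].
  have /drawsP[sA cA] := subsetP sF _ AF.
  by apply/drawsP; rewrite subsetDl cardsDS // cI cA en; split=> //; clear; lia.
rewrite cardsU disjoint_setI0 // cards0 subn0 cC card_drawsE cI /hm_size.
have -> : n - k.+1 - 2 = k.+1 by lia.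
have -> : n = n.-1.+1 by lia.
have e : n.-1 - k.+2 = k.+1 by lia.
rewrite binn binS -(@bin_sub n.-1 k.+2) ?e; last by lia.
by rewrite /=; have : 0 < 'C(n.-1, k.+1) by [rewrite bin_gt0; lia]; lia.
Qed.

(** Induction on [n], starting from the complementary case, then on the weight. A shift that changes
    [F] either stays nontrivial and lowers the weight, or shows that [i] and [j] cover [F]; if no
    shift changes [F], the family is shifted. *)
Theorem hilton_milner n k F : n <= N -> 2 * k.+2 <= n ->
  F \subset draws (initial n) k.+2 -> crossing F F -> nontrivial F ->
  #|F| <= hm_size n k.+1 /\
  (1 < k -> 2 * k.+2 < n -> hm_size n k.+1 <= #|F| ->
   exists2 x, x \in initial n & #|missing F x| <= 1).
Proof.
elim: n k F => // n IHn k F nN kn sF iF ntF.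
have [en|kn'] := eqVneq n.+1 (2 * k.+2).
  by split; [exact: hilton_milner_complement | lia].
have {}kn' : 2 * k.+2 <= n by lia.
suff [le good] : hm_spec n.+1 k F by split=> // k1 _; apply: good.
have [m] := ubnP (\sum_(A in F) weight (@nat_of_ord N) A).
elim: m F sF iF ntF => // m IHm F sF iF ntF; rewrite ltnS => Fm.
have [/existsP[i /existsP[j /and3P[ij jn nF]]]|] :=
    boolP [exists i : T, exists j : T, [&& i < j, j < n.+1 & shift i j F != F]]; last first.
  move=> noshift; apply: shifted_step => //.
    move=> i j A ij jn AF iA; apply: shift_id_swap AF iA; apply/eqP/negPn/negP=> ne.
    move/negP: noshift; apply; apply/existsP; exists i; apply/existsP; exists j.
    by rewrite ij jn ne.
  by move=> k' F' kn1 sF' iF' nt'; case: (IHn k' F' (ltnW nN)).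
have iX : i \in initial n.+1 by rewrite inE (ltn_trans ij).
have jX : j \in initial n.+1 by rewrite inE.
have nij : i != j by rewrite -val_eqE /= neq_ltn ij.
have kX : 2 * k.+2 < #|initial n.+1| by rewrite card_initial // ltnS.
have [nt|nt] := boolP (nontrivial (shift i j F)); last first.
  have F0 := shift_nontrivial ntF nt.
  split; first by have := pair_bound sF iF iX jX nij kX ntF F0; rewrite card_initial.
  by move=> k1 ge; apply: (pair_good sF iF iX jX nij kX); rewrite ?F0 ?cards0 ?card_initial.
have [||||le good] := IHm (shift i j F) => //.
- exact: shift_draws.
- exact: shift_crossing.
- by apply: leq_trans Fm; apply: shift_weight.
rewrite card_shift in le good; split=> // k1 ge.
(* If [x] does not serve for [F] as well, at most one member avoids both [i] and [j], and
   [pair_good] applies. *)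
have [x xX /shift_missing[le1|le1]] := good k1 ge; last by exists x.
by apply: (pair_good sF iF iX jX nij kX); rewrite ?card_initial.
Qed.

End HiltonMilner.

(** * Multisets with given support *)

Local Open Scope fset_scope.
Local Open Scope mset_scope.
Local Open Scope nat_scope.

Section Support.
Variable m : nat.
Implicit Types (A B : {mset 'I_m}) (S : {set 'I_m}) (j k p : nat) (i a : 'I_m).

Definition supp A : {set 'I_m} := [set i | i \in A].

Lemma in_supp A i : (i \in supp A) = (i \in A).
Proof. by rewrite inE. Qed.

Lemma size_msetE A : size A = \sum_(i : 'I_m) A i.
Proof.
rewrite -sum1_size (partition_big id predT) //=; apply: eq_bigr => i _.
by rewrite sum1_count count_mem_mset.
Qed.

Lemma card_supp_le A : #|supp A| <= size A.
Proof.
rewrite size_msetE -sum1_card big_mkcond; apply: leq_sum => i _.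
by rewrite in_supp; case: ifP; rewrite // -mset_gt0.
Qed.

Lemma size_msetDn A B : size (A `+` B)%mset = size A + size B.
Proof. by rewrite !size_msetE -big_split; apply: eq_bigr => i _; rewrite msetE2. Qed.

Lemma size_mset1D a A : size (a +` A)%mset = (size A).+1.
Proof.
by rewrite -{1}(seq_mset_id A) -mset_cons (perm_size (perm_eq_seq_mset _)).
Qed.

Lemma size_mset_of_set S : size (mset_of_set S) = #|S|.
Proof. by rewrite (perm_size (perm_eq_seq_mset _)) -cardE. Qed.

Lemma supp_eq0 A : (supp A == set0) = (A == mset0).
Proof.
apply/eqP/eqP=> [e|->]; last by apply/setP=> i; rewrite !inE in_mset0.
by apply/msetP=> i; rewrite mset0E; apply/eqP; rewrite mset_eq0 -in_supp e inE.
Qed.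

Lemma fset_msetP (X Y : {fset {mset 'I_m}}) :
  (forall A, (A \in X) = (A \in Y)) -> X = Y.
Proof. by move=> e; apply/fsetP. Qed.

Definition kmsets_with (P : pred {set 'I_m}) k : {fset {mset 'I_m}} :=
  [fset A in kmsets m k | P (supp A)]%fset.

Lemma in_kmsets_with P k A : (A \in kmsets_with P k) = (size A == k) && P (supp A).
Proof. by rewrite !inE in_kmsets. Qed.

(** Pascal's rule at a point [a] of [S]: either [a] is absent, or one copy of it is removed. The
    truncated predecessor gives the right value 1 when [S] is empty and [k = 0]. *)
Lemma card_kmsets_within S k :
  #|` kmsets_with (fun R => R \subset S) k|%fset = 'C((#|S| + k).-1, k).
Proof.
have [n] := ubnP (#|S| + k); elim: n S k => // n IHn S [|k]; rewrite ltnS => le.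
  rewrite bin0; suff -> : kmsets_with (fun R => R \subset S) 0 = [fset mset0]%fset by rewrite cardfs1.
  apply: fset_msetP => A; apply/idP/fset1P => [|->]; rewrite in_kmsets_with size_mset_eq0.
    by case/andP=> /eqP.
  by rewrite eqxx (eqP (_ : supp mset0 == set0)) ?supp_eq0 ?sub0set.
have [->|[a aS]] := set_0Vmem S.
  rewrite cards0 add0n bin_small //; apply/eqP; rewrite cardfs_eq0; apply/eqP/fset_msetP=> A.
  rewrite in_kmsets_with subset0 supp_eq0 -size_mset_eq0 in_fset0.
  by case: eqP => // ->.
have cS := cardsD1 a S; rewrite aS add1n in cS.
have -> : kmsets_with (fun R => R \subset S) k.+1 =
   (kmsets_with (fun R => R \subset S :\ a) k.+1 `|`
    [fset (a +` A)%mset | A in kmsets_with (fun R => R \subset S) k])%fset.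
  apply: fset_msetP => A; apply/idP/fsetUP.
    rewrite in_kmsets_with => /andP[sA SA]; have [aA|aA] := boolP (a \in A); last first.
      by left; rewrite in_kmsets_with sA subsetD1 SA inE.
    right; apply/imfsetP; exists (A `\ a)%mset; last by rewrite msetB1K.
    rewrite /= in_kmsets_with -eqSS -(size_mset1D a) msetB1K // sA /=.
    apply: subset_trans SA; apply/subsetP=> i; rewrite !inE in_msetB1.
    by case/andP.
  rewrite in_kmsets_with; case=> [|/imfsetP[B /=]]; rewrite in_kmsets_with => /andP[].
    move=> -> SA; apply: subset_trans SA (subsetDl _ _).
  move=> sB SB ->; rewrite size_mset1D eqSS sB /=.
  apply/subsetP=> i; rewrite inE in_mset1D => /orP[/eqP->//|iB].
  by apply: (subsetP SB); rewrite inE.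
rewrite cardfsU (_ : (_ `&` _)%fset = fset0) ?cardfs0 ?subn0; last first.
  apply: fset_msetP => A; rewrite in_fset0 in_fsetI in_kmsets_with subsetD1 inE.
  apply/negP=> /andP[/and3P[_ _ aA] /imfsetP[B _ e]].
  by rewrite e mset1D1 in aA.
rewrite IHn; last by lia.
rewrite card_imfset; last by apply: can_inj (fun A => (A `\ a)%mset) _; apply: msetD1K.
rewrite -[size _]/(#|` kmsets_with (fun R => R \subset S) k|)%fset IHn; last by lia.
rewrite cS !addSn !addnS /= binS.
by [].
Qed.

(** Removing one copy of each element of [S] leaves an arbitrary multiset within [S]. *)
Lemma card_kmsets_supp S k : #|S| <= k ->
  #|` kmsets_with (pred1 S) k|%fset = 'C(k.-1, k - #|S|).
Proof.
move=> Sk; pose ind := mset_of_set S.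
have -> : kmsets_with (pred1 S) k =
    [fset (A `+` ind)%mset | A in kmsets_with (fun R => R \subset S) (k - #|S|)]%fset.
  apply: fset_msetP => A; rewrite in_kmsets_with; apply/andP/imfsetP => /=.
    case=> /eqP sA /eqP eS.
    have le : (ind `<=` A)%mset.
      apply/msubsetP=> i; rewrite mset_of_setE -eS inE -mset_gt0.
      by case: (A i).
    exists (A `\` ind)%mset; last by rewrite msetBDK.
    rewrite in_kmsets_with -(eqn_add2r #|S|) -{1}size_mset_of_set -size_msetDn.
    rewrite msetBDK // sA subnK // eqxx /=.
    apply/subsetP=> i; rewrite inE in_msetB => lt.
    by rewrite -eS in_supp -mset_gt0 (leq_ltn_trans _ lt).
  case=> B; rewrite in_kmsets_with => /andP[/eqP sB SB] ->.
  rewrite size_msetDn sB size_mset_of_set subnK // eqxx; split=> //=.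
  apply/eqP/setP=> i; rewrite inE in_msetD -[i \in ind]mset_gt0 mset_of_setE.
  case iS: (i \in S); first by rewrite orbT.
  rewrite orbF; apply/negP=> iB.
  by have := subsetP SB i; rewrite inE iS => /(_ iB).
rewrite card_imfset; last by apply: can_inj (fun A => (A `\` ind)%mset) _ => A; rewrite msetDC msetDKB.
rewrite -[size _]/(#|` kmsets_with (fun R => R \subset S) (k - #|S|)|)%fset.
by rewrite card_kmsets_within subnKC.
Qed.

End Support.

(** * Traces of sets on an initial part of the ground set *)

Section Trace.
Variables m p : nat.
Implicit Types (B : {set 'I_(m + p)}) (S : {set 'I_m}) (D : {set 'I_p}).

Definition trace B : {set 'I_m} := [set i | lshift p i \in B].

Definition join S D : {set 'I_(m + p)} :=
  [set x | match split x with inl i => i \in S | inr j => j \in D end].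

Lemma in_join_l S D i : (lshift p i \in join S D) = (i \in S).
Proof. by rewrite inE (unsplitK (inl i)). Qed.

Lemma in_join_r S D j : (rshift m j \in join S D) = (j \in D).
Proof. by rewrite inE (unsplitK (inr j)). Qed.

Lemma join_trace B : join (trace B) [set j | rshift m j \in B] = B.
Proof.
apply/setP=> x; rewrite -(splitK x); case: (split x) => y /=.
  by rewrite in_join_l inE.
by rewrite in_join_r inE.
Qed.

Lemma trace_join S D : trace (join S D) = S.
Proof. by apply/setP=> i; rewrite inE in_join_l. Qed.

Lemma card_join S D : #|join S D| = #|S| + #|D|.
Proof.
rewrite -!sum1_card big_mkcond big_split_ord /= [in RHS]big_mkcond [X in _ = _ + X]big_mkcond.
by congr (_ + _); apply: eq_bigr => i _; rewrite ?in_join_l ?in_join_r.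
Qed.

Lemma card_trace_le B : #|trace B| <= #|B|.
Proof. by rewrite -{2}(join_trace B) card_join leq_addr. Qed.

Lemma card_trace_fiber S k : #|S| <= k ->
  #|[set B : {set 'I_(m + p)} | (#|B| == k) && (trace B == S)]| = 'C(p, k - #|S|).
Proof.
move=> Sk; have -> : 'C(p, k - #|S|) = #|[set D : {set 'I_p} | #|D| == k - #|S|]|.
  by rewrite card_draws card_ord.
rewrite -[RHS](card_in_imset (f := join S)); last first.
  by move=> D D' _ _ e; apply/setP=> j; rewrite -(in_join_r S) e in_join_r.
apply: eq_card => B; rewrite inE; apply/andP/imsetP.
  case=> /eqP cB /eqP eS; exists [set j | rshift m j \in B].
    by rewrite inE -(eqn_add2l #|S|) subnKC // -{1}eS -card_join join_trace cB.
  by rewrite -eS join_trace.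
case=> D; rewrite inE => /eqP cD ->.
by rewrite card_join cD subnKC // eqxx trace_join.
Qed.

End Trace.

(* Both sides are counted by the support: a support of size s carries
   'C(k.-1, k - s) multisets, and equally many k-sets with that trace. *)
Lemma card_kmsets_with m k (P : pred {set 'I_m}) :
  #|` kmsets_with P k| =
  #|[set B : {set 'I_(m + k.-1)} | (#|B| == k) && P (trace B)]|.
Proof.
rewrite card_fset_sum1 (partition_big (@supp m) predT) //=.
rewrite -[RHS]sum1_card (partition_big (@trace m k.-1) predT) //=.
apply: eq_bigr => S _; rewrite sum1dep_card big_fset_condE -card_fset_sum1.
have [PS|PS] := boolP (P S); last first.
  rewrite (_ : [fset _ in _ | _] = fset0); last first.
    apply: fset_msetP => A; rewrite in_fset0; apply/negP; rewrite !inE /=.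
    by case/andP=> /andP[_ +] /eqP e; rewrite e (negPf PS).
  rewrite cardfs0; apply/esym/eqP; rewrite cards_eq0; apply/eqP/setP=> B; rewrite !inE.
  by apply/negP=> /andP[/andP[_ +] /eqP e]; rewrite e (negPf PS).
rewrite (_ : [fset _ in _ | _] = kmsets_with (pred1 S) k); last first.
  apply: fset_msetP => A; rewrite in_kmsets_with !inE in_kmsets /= -andbA.
  by case: (supp A =P S) => [->|]; rewrite ?PS ?andbF.
have [Sk|Sk] := leqP #|S| k; last first.
  rewrite (_ : kmsets_with _ _ = fset0); last first.
    apply: fset_msetP => A; rewrite in_fset0 in_kmsets_with; apply/negP.
    case/andP=> /eqP sA /eqP eS; move: Sk; rewrite ltnNge -eS -sA => /negP[].
    exact: card_supp_le.
  rewrite cardfs0; apply/esym/eqP; rewrite cards_eq0; apply/eqP/setP=> B; rewrite !inE.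
  apply/negP=> /andP[/andP[/eqP cB _] /eqP e].
  by have := card_trace_le B; rewrite e cB leqNgt Sk.
rewrite card_kmsets_supp // -(@card_trace_fiber m k.-1) //.
apply: eq_card => B; rewrite !inE.
by case: (trace B =P S) => [->|]; rewrite ?PS ?andbF ?andbT.
Qed.

(** * From multisets to sets *)

(** The extremal family in terms of supports. When |S| is the size of the multisets, the only one
    with support [S] is [S] itself. *)
Definition hm_pred m (x : 'I_m) (S R : {set 'I_m}) :=
  (x \in R) && (R :&: S != set0) || (R == S).

Lemma initial_full n : initial n n = [set: 'I_n].
Proof. by apply/setP=> i; rewrite !inE ltn_ord. Qed.

(** On the side of sets, a star meeting the copy of [S] is counted, plus the one set with trace [S],
    which is outside the star as [x] is not in [S]. *)
Lemma card_hm_kmsets m k (x : 'I_m) (S : {set 'I_m}) : #|S| = k.+1 -> x \notin S ->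
  #|` kmsets_with (hm_pred x S) k.+1| = hm_size (m + k) k.
Proof.
move=> cS xS; rewrite card_kmsets_with /=.
pose L : {set 'I_(m + k)} := [set lshift k i | i in S].
pose U := [set B in draws [set: 'I_(m + k)] k.+1 | (lshift k x \in B) && (B :&: L != set0)].
pose V := [set B : {set 'I_(m + k)} | (#|B| == k.+1) && (trace B == S)].
have -> : [set B : {set 'I_(m + k)} | (#|B| == k.+1) && hm_pred x S (trace B)] = U :|: V.
  apply/setP=> B; rewrite !inE /hm_pred subsetT inE -andb_orr /=; congr (_ && (_ && _ || _)).
  apply/setI_neq0P/setI_neq0P => [[i iB iS]|[z zB /imsetP[i iS e]]].
    by exists (lshift k i); [move: iB; rewrite inE | apply: imset_f].
  by exists i; rewrite // inE -e.
have dUV : U :&: V = set0.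
  apply/setP=> B; rewrite in_set0 in_setI; apply/negP=> /andP[].
  rewrite !inE => /andP[_ /andP[xB _]] /andP[_ /eqP e].
  by rewrite -e inE xB in xS.
rewrite cardsU dUV cards0 subn0 card_trace_fiber ?cS // subnn bin0.
rewrite card_meeting_star ?inE //; last first.
  by apply/imsetP=> -[i iS /lshift_inj e]; rewrite e iS in xS.
rewrite cardsT card_ord card_imset; last exact: lshift_inj.
by rewrite cS /hm_size; congr (_ - 'C(_, _) + _); lia.
Qed.

Section Reduction.
Variables (m k : nat) (F : {fset {mset 'I_m}}).
Hypotheses (km : k.+2 <= m - 1) (F0 : F != fset0).
Hypotheses (sizeF : forall A : {mset 'I_m}, A \in F -> size A = k.+2).
Hypotheses (iF : intersecting F) (F_bigcap : mset_bigcap F = mset0).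
Implicit Types (A : {mset 'I_m}) (R S : {set 'I_m}).
Notation T := 'I_(m + k.+1).
Implicit Types (B Z : {set T}).

Let covers R := has (fun A : {mset 'I_m} => supp A \subset R) (enum_fset F).

Let coversP R : reflect (exists2 A : {mset 'I_m}, A \in F & supp A \subset R) (covers R).
Proof. exact: hasP. Qed.

Let F' : {set {set T}} := [set B : {set T} | (#|B| == k.+2) && covers (trace B)].

Let F_missing (i : 'I_m) : exists2 A : {mset 'I_m}, A \in F & i \notin A.
Proof.
apply/hasP; rewrite has_predC; apply/negP=> /allP h.
have /negP[] : ~~ (0 < mset_bigcap F i) by rewrite F_bigcap mset0E.
by apply/(mset_bigcapE i 1 F0) => A AF; rewrite mset_gt0; exact: h.
Qed.

Let supp_meet A A' : A \in F -> A' \in F -> exists2 i, i \in supp A & i \in supp A'.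
Proof.
move=> AF AF'; have := iF AF AF'; rewrite -supp_eq0 => /set0Pn[i].
by rewrite in_supp in_msetI => /andP[iA iA']; exists i; rewrite in_supp.
Qed.

Let card_le_lift : #|` F| <= #|F'|.
Proof.
rewrite -(card_kmsets_with k.+2 covers); apply/fsubset_leq_card/fsubsetP=> A AF.
by rewrite in_kmsets_with sizeF // eqxx; apply/coversP; exists A.
Qed.

Let lift_draws : F' \subset draws (initial (m + k.+1) (m + k.+1)) k.+2.
Proof. by apply/subsetP=> B; rewrite inE initial_full => /andP[cB _]; rewrite inE subsetT. Qed.

Let lift_crossing : crossing F' F'.
Proof.
apply/crossingP=> B B'; rewrite !inE => /andP[_ /coversP[A AF sA]] /andP[_ /coversP[A' AF' sA']].
have [i iA iA'] := supp_meet AF AF'.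
apply/setI_neq0P; exists (lshift k.+1 i).
  by have := subsetP sA _ iA; rewrite inE.
by have := subsetP sA' _ iA'; rewrite inE.
Qed.

Let lift_supp A : {set T} := [set lshift k.+1 i | i in supp A].

Let lift_extend A Z : A \in F -> lift_supp A \subset Z -> k.+2 <= #|Z| ->
  exists B, [/\ B \in F', lift_supp A \subset B & B \subset Z].
Proof.
move=> AF sZ cZ.
have [|B [sB sBZ cB]] := @exists_draw _ _ _ k.+2 sZ.
  by rewrite cZ card_imset; [rewrite -(sizeF AF) card_supp_le | apply: lshift_inj].
exists B; split=> //; rewrite inE cB eqxx; apply/coversP; exists A => //.
by apply/subsetP=> i iA; rewrite inE; apply/(subsetP sB)/imset_f.
Qed.

Let lift_suppC A x y : x \notin lift_supp A -> y \notin lift_supp A ->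
  lift_supp A \subset ~: [set x; y] /\ k.+2 <= #|~: [set x; y]|.
Proof.
move=> xA yA; split.
  by apply/subsetP=> z zA; rewrite !inE; apply/negP=> /orP[]/eqP e; rewrite -e zA in xA yA.
rewrite cardsCs setCK card_ord cards2; case: (x != y); clear -km; lia.
Qed.

Let lift_nontrivial : nontrivial F'.
Proof.
apply/nontrivialP=> c.
have [A AF cA] : exists2 A : {mset 'I_m}, A \in F & c \notin lift_supp A.
  rewrite -(splitK c); case: (split c) => i /=.
    have [A AF iA] := F_missing i; exists A => //.
    by apply/imsetP=> -[j jA /lshift_inj e]; rewrite e -in_supp jA in iA.
  case/fset0Pn: F0 => A AF; exists A => //.
  by apply/imsetP=> -[j jA /eqP]; rewrite eq_rlshift.
have [sZ cZ] := lift_suppC cA cA.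
have [B [BF _ BZ]] := lift_extend AF sZ cZ.
exists B => //; apply/negP=> cB; have := subsetP BZ _ cB.
by rewrite !inE eqxx.
Qed.

Lemma kmsets_bound : #|` F| <= hm_size (m + k.+1) k.+1.
Proof.
apply: leq_trans card_le_lift _.
have [] := hilton_milner (leqnn _) _ lift_draws lift_crossing lift_nontrivial => //.
by clear -km; lia.
Qed.

(** It suffices to locate the point missed by a single member of [F'] and to show that the members
    of [F] missing it share a full-size support. This puts [F] inside an extremal family of no
    larger size. *)
Lemma kmsets_extremal : 1 < k -> k.+2 < m - 1 -> hm_size (m + k.+1) k.+1 <= #|` F| ->
  exists x S, [/\ x \notin S, #|S| = k.+2 & F = kmsets_with (hm_pred x S) k.+2].
Proof.
move=> k1 km' ge.
have kN : 2 * k.+2 < m + k.+1 by clear -km'; lia.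
have [_ good] := hilton_milner (leqnn _) (ltnW kN) lift_draws lift_crossing lift_nontrivial.
have [x _ /card_le1_eqP uniq] := good k1 kN (leq_trans ge card_le_lift).
have {}uniq B B' : B \in F' -> B' \in F' -> x \notin B -> x \notin B' -> B = B'.
  by move=> h1 h2 h3 h4; apply: uniq; rewrite inE ?h1 ?h2.
have ex2 A y : A \in F -> x \notin lift_supp A -> y \notin lift_supp A ->
    exists B, [/\ B \in F', lift_supp A \subset B, x \notin B & y \notin B].
  move=> AF xA yA; have [sZ cZ] := lift_suppC xA yA.
  have [B [BF sB BZ]] := lift_extend AF sZ cZ; exists B.
  by split=> //; apply/negP=> h; have := subsetP BZ _ h; rewrite !inE eqxx ?orbT.
(* If [x] were one of the added points, no support would contain it. The member [Y] missing [x] has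
   a point [i] in [m], and a multiset without [i] extends to another member avoiding both [x] and
   [i]. *)
have [x0 ex] : exists x0, x = lshift k.+1 x0.
  case: (split_ordP x) => [x0 ->|j ex]; first by exists x0.
  have xA A : x \notin lift_supp A.
    by apply/imsetP=> -[i _ /eqP]; rewrite ex eq_rlshift.
  have [Y YF xY] := nontrivialP _ lift_nontrivial x.
  have := YF; rewrite inE => /andP[_ /coversP[A AF sA]].
  have [i iA _] := supp_meet AF AF.
  have := subsetP sA _ iA; rewrite inE => iY.
  have [A' AF' iA'] := F_missing i.
  have nA' : lshift k.+1 i \notin lift_supp A'.
    by apply/imsetP=> -[i' jA /lshift_inj e]; rewrite e -in_supp jA in iA'.
  have [B [BF _ xB iB]] := ex2 _ _ AF' (xA A') nA'.
  by rewrite (uniq _ _ BF YF xB xY) iY in iB.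
have nlift A : x0 \notin A -> x \notin lift_supp A.
  by move=> xA; apply/imsetP=> -[j jA]; rewrite ex => /lshift_inj e; rewrite e -in_supp jA in xA.
(* If the support had fewer than [k.+2] points, its extension could be rechosen so as to avoid an
   added point [y], giving two members that miss [x]. *)
have full A : A \in F -> x0 \notin A -> lift_supp A \in F'.
  move=> AF /nlift xA; have [B [BF sB xB _]] := ex2 _ _ AF xA xA.
  have [e|ne] := eqVneq (lift_supp A) B; first by rewrite e.
  have : lift_supp A \proper B by rewrite properEneq ne.
  case/properP=> _ [y yB yA]; have [B' [BF' _ xB' yB']] := ex2 _ _ AF xA yA.
  by rewrite -(uniq _ _ BF BF' xB xB') yB in yB'.
have [A0 AF0 xA0] := F_missing x0.
exists x0, (supp A0).
have cS : #|supp A0| = k.+2.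
  have := full _ AF0 xA0; rewrite inE => /andP[/eqP + _].
  by rewrite card_imset //; apply: lshift_inj.
have xS : x0 \notin supp A0 by rewrite in_supp.
split=> //; apply/eqP; rewrite eqEfcard card_hm_kmsets // ge andbT.
suff sub A : A \in F -> A \in kmsets_with (hm_pred x0 (supp A0)) k.+2.
  by apply/fsubsetP=> A; apply: sub.
move=> AF; rewrite in_kmsets_with sizeF // eqxx /=.
have [xA|xA] := boolP (x0 \in A); rewrite /hm_pred in_supp.
  by rewrite xA; apply/orP; left; apply/setI_neq0P/supp_meet.
apply/orP; right; apply/eqP.
have e := uniq _ _ (full _ AF xA) (full _ AF0 xA0) (nlift _ xA) (nlift _ xA0).
exact: imset_inj (@lshift_inj _ _) _ _ e.
Qed.

End Reduction.

(** * Relabelling the ground set *)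

Section Relabel.
Variable m : nat.
Implicit Types (A : {mset 'I_m}) (S : {set 'I_m}) (q : {perm 'I_m}).

Lemma perm_msetK q : cancel (perm_mset q) (perm_mset q^-1).
Proof.
by move=> A; apply/msetP=> i; rewrite -[i in LHS](permK q) !perm_msetE.
Qed.

Lemma size_perm_mset q A : size (perm_mset q A) = size A.
Proof. by rewrite (perm_size (perm_eq_seq_mset _)) size_map. Qed.

Lemma supp_perm_mset q A : supp (perm_mset q A) = q @: supp A.
Proof.
apply/setP=> i; rewrite -[i](permKV q) in_supp -mset_gt0 perm_msetE mset_gt0.
by rewrite mem_imset ?in_supp //; apply: perm_inj.
Qed.

Lemma perm_hm_kmsets q x S k :
  [fset perm_mset q A | A in kmsets_with (hm_pred x S) k] =
  kmsets_with (hm_pred (q x) (q @: S)) k.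
Proof.
have hmq (R : {set 'I_m}) : hm_pred (q x) (q @: S) (q @: R) = hm_pred x S R.
  rewrite /hm_pred mem_imset; last exact: perm_inj.
  rewrite -imsetI ?imset_eq0 ?(inj_eq (imset_inj (@perm_inj _ q))) //.
  by move=> u v _ _; apply: perm_inj.
apply: fset_msetP => A; rewrite in_kmsets_with; apply/imfsetP/idP => /= [[B]|].
  by rewrite in_kmsets_with => h ->; rewrite size_perm_mset supp_perm_mset hmq.
exists (perm_mset q^-1 A); last by have := perm_msetK q^-1 A; rewrite invgK.
rewrite in_kmsets_with size_perm_mset -hmq -supp_perm_mset.
by have := perm_msetK q^-1 A; rewrite invgK => ->.
Qed.

(** Both ground sets are listed as the point, then the set, then the rest; the permutation matches
    equal positions. *)
Lemma exists_perm_pointed x y S S' : #|S| = #|S'| -> x \notin S -> y \notin S' ->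
  exists2 q : {perm 'I_m}, q x = y & q @: S = S'.
Proof.
move=> cS xS yS'; pose L (z : 'I_m) (R : {set 'I_m}) : seq 'I_m := z :: enum R ++ enum (~: (z |: R)).
have sizeL z (R : {set 'I_m}) : z \notin R -> size (L z R) = m.
  move=> zR; rewrite /= size_cat -!cardE -[RHS](card_ord m) -(cardsC (z |: R)) cardsU1 zR.
  by rewrite add1n addSn.
have memL z (R : {set 'I_m}) i : i \in L z R.
  by rewrite inE mem_cat !mem_enum !inE; case: (i == z); case: (i \in R).
have uniqL z (R : {set 'I_m}) : z \notin R -> uniq (L z R).
  move=> zR; rewrite /= mem_cat !mem_enum !inE eqxx (negPf zR) /=.
  rewrite cat_uniq !enum_uniq /= andbT; apply/hasPn=> i.
  by rewrite !mem_enum !inE negb_or => /andP[].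
pose f i := nth y (L y S') (index i (L x S)).
have ltL i : index i (L x S) < size (L y S').
  by rewrite (sizeL y S') //; have := memL x S i; rewrite -index_mem (sizeL x S).
have f_inj : injective f.
  move=> i j /eqP; rewrite nth_uniq ?uniqL // => /eqP e.
  by rewrite -(nth_index x (memL x S i)) e nth_index.
exists (perm f_inj); first by rewrite permE /f /= eqxx.
apply/eqP; rewrite eqEcard card_imset; last exact: perm_inj.
rewrite cS leqnn andbT; apply/subsetP=> _ /imsetP[i iS ->]; rewrite permE /f /=.
have -> : x == i = false by apply: contraNF xS => /eqP->.
have lt : index i (enum S) < size (enum S) by rewrite index_mem mem_enum.
rewrite index_cat mem_enum iS /= nth_cat -cardE -cS cardE lt -mem_enum mem_nth //.
by rewrite -cardE -cS cardE.
Qed.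

(** By [card_kmsets_supp] the number of such multisets is 'C(|S| - 1, 0) = 1. *)
Lemma mset_of_set_unique A S : size A = #|S| -> supp A = S -> A = mset_of_set S.
Proof.
move=> sA eS; have := card_kmsets_supp (leqnn #|S|); rewrite subnn bin0 => /eqP/cardfs1P[B eB].
have mem D : (D \in kmsets_with (pred1 S) #|S|) = (D == B) by rewrite eB in_fset1.
have /eqP-> : A == B by rewrite -mem in_kmsets_with sA eqxx /= eS.
apply/esym/eqP; rewrite -mem in_kmsets_with size_mset_of_set eqxx /=.
by apply/eqP/setP=> i; rewrite in_supp -mset_gt0 mset_of_setE lt0b.
Qed.

Lemma card_ground_itv k : k < m -> #|ground_itv m 2 k.+1| = k.
Proof.
move=> km; pose o : 'I_m := Ordinal (leq_ltn_trans (leq0n k) km).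
have -> : ground_itv m 2 k.+1 = initial m k.+1 :\ o.
  by apply/setP=> i; rewrite !inE -val_eqE /= !ltnS lt0n.
have := cardsD1 o (initial m k.+1); rewrite card_initial // inE add1n.
by case.
Qed.

Lemma Ftilde_kmsets k (hm0 : 0 < m) : k <= m - 1 ->
  Ftilde k hm0 = kmsets_with (hm_pred (Ordinal hm0) (ground_itv m 2 k.+1)) k.
Proof.
move=> km; have cS : #|ground_itv m 2 k.+1| = k by apply: card_ground_itv; lia.
set S := ground_itv m 2 k.+1 in cS *.
have suppS : supp (mset_of_set S) = S.
  by apply/setP=> i; rewrite in_supp -mset_gt0 mset_of_setE lt0b.
apply: fset_msetP => A; rewrite in_kmsets_with /hm_pred in_supp.
have -> : supp A :&: S != set0 = ((A `&` mset_of_set S)%mset != mset0).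
  rewrite -supp_eq0; congr (_ != _); apply/setP=> i.
  by rewrite in_setI !in_supp in_msetI -[in X in _ = _ && X]in_supp suppS.
apply/fsetUP/andP => [[|/fset1P->]|[sA /orP[h|/eqP eS]]].
- by rewrite !inE in_kmsets => /andP[-> ->].
- by rewrite size_mset_of_set cS suppS !eqxx orbT.
- by left; rewrite !inE in_kmsets sA.
by right; apply/fset1P; apply: mset_of_set_unique; rewrite // cS; apply/eqP.
Qed.

End Relabel.

Theorem theorem3p3 (m k : nat) (hm : 0 < m) (hk : 0 < k)
    (hkm : 1 < k <= m - 1) (F : {fset {mset 'I_m}%mset}%fset)
    (F_kmset : forall A : {mset 'I_m}%mset, A \in F -> size A = k)
    (F_intersecting : intersecting F)
    (F_bigcap : mset_bigcap F = mset0) :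
  #|` F|%fset <= 'C(m + k - 2, k - 1) - 'C(m - 2, k - 1) + 1 /\
  (3 < k < m - 1 ->
    (#|` F|%fset = 'C(m + k - 2, k - 1) - 'C(m - 2, k - 1) + 1 <->
     isomorphic F (Ftilde k hm))).
Proof.
case: k hk hkm F_kmset => [|[|k]] // _ /andP[_ km] sizeF.
have eB : 'C(m + k.+2 - 2, k.+2 - 1) - 'C(m - 2, k.+2 - 1) + 1 = hm_size (m + k.+1) k.+1.
  by rewrite /hm_size subn1; congr ('C(_, _) - 'C(_, _) + 1); clear -km; lia.
have cardHM (x : 'I_m) (S : {set 'I_m}) : #|S| = k.+2 -> x \notin S ->
    #|` kmsets_with (hm_pred x S) k.+2|%fset = hm_size (m + k.+1) k.+1.
  by exact: card_hm_kmsets.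
pose S0 := ground_itv m 2 k.+3; pose o := Ordinal hm.
have cS0 : #|S0| = k.+2 by apply: card_ground_itv; clear -km; lia.
have oS0 : o \notin S0 by rewrite inE.
rewrite eB; split.
  (* The intersection of the empty family is [mset0] by convention, so this family satisfies the
     hypotheses and is treated apart. *)
  have [->|F0] := eqVneq F fset0; first by rewrite cardfs0.
  exact: kmsets_bound.
case/andP=> k4 km'; rewrite /isomorphic Ftilde_kmsets //; split=> [e|[q ->]].
  have F0 : F != fset0 by rewrite -cardfs_gt0 e /hm_size addn1.
  have ge : hm_size (m + k.+1) k.+1 <= #|` F|%fset by rewrite e.
  have [x [S [xS cS ->]]] := kmsets_extremal km F0 sizeF F_intersecting F_bigcap k4 km' ge.
  have [q qx qS] := exists_perm_pointed (etrans cS0 (esym cS)) oS0 xS.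
  by exists q; rewrite perm_hm_kmsets -/o qx qS.
(* Relabelling yields a family of the same form for another point and set, whose size is known. *)
rewrite perm_hm_kmsets cardHM //.
  by rewrite card_imset //; apply: perm_inj.
by rewrite mem_imset //; apply: perm_inj.
Qed.
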